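(* Let $\delta\in(0,1/3)$, $n\ge1$, $d\ge1$, and let $k\in\{1,\dots,n\}$ be an integer with $k\ge8\log(4(2n+1)^{d+1}/\delta)$. Suppose that: (a) $(X,Y),(X_1,Y_1),\dots,(X_n,Y_n)$ are independent and identically distributed; (b) conditionally on $X$, the noise $\varepsilon=Y-g(X)$ is sub-Gaussian with parameter $\sigma^2$: $\mathbb E[\varepsilon\mid X]=0$ and $\mathbb E[\exp(s\varepsilon)\mid X]\le\exp(s^2\sigma^2/2)$ for all $s\in\mathbb R$; (c) $g$ is $L$-Lipschitz on $S_X$ with respect to $\|\cdot\|_2$; (d) there are a positive function $\ell$ on $S_X$ and $T_0>0$ such that $P^X(B(x,\tau))\ge\ell(x)\tau^d$ for all $x\in S_X$ and all $\tau\in(0,T_0)$. Let $\mathcal V(x)=B(x,\hat\tau_{n,k}(x))$ be the $k$-nearest-neighbor local map. Then, with probability at least $1-3\delta$, for all $x\in S_X$ such that $2k\le T_0^d\,n\,\ell(x)$, $$|\hat g_{\mathcal V}(x)-g(x)|\le\sqrt{\frac{2\sigma^2}{k}\log\left(\frac{(n+1)^{d+1}}{\delta}\right)}+2\left(\frac{2k}{n\,\ell(x)}\right)^{1/d}L(\mathcal V(x)).$$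
   Context: $(X,Y)$ is a random vector with $X\in S_X\subset\mathbb R^d$ and $Y\in\mathbb R$; $g(x)=\mathbb E[Y\mid X=x]$; $P^X$ is the law of $X$. $B(x,r)$ is the closed Euclidean ball of center $x$ and radius $r$. The $k$-NN radius $\hat\tau_{n,k}(x)$ is the smallest $\tau>0$ such that $\sum_{i=1}^n\mathbf 1_{B(x,\tau)}(X_i)\ge k$. The estimator is $\hat g_{\mathcal V}(x)=\sum_{i=1}^nY_i\mathbf 1_{\mathcal V(x)}(X_i)/\sum_{i=1}^n\mathbf 1_{\mathcal V(x)}(X_i)$. For $V\subset\mathbb R^d$, $L(V)$ is the smallest constant $c$ such that $|g(x)-g(y)|\le c\|x-y\|_2$ for all $x,y\in V\cap S_X$. *)

(* Defs.v *)
From HB Require Import structures.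
From mathcomp Require Import all_boot all_order all_algebra.
From mathcomp Require Import all_classical all_reals all_analysis.

Set Implicit Arguments.
Unset Strict Implicit.
Unset Printing Implicit Defensive.

Import Order.TTheory GRing.Theory Num.Theory.

Local Open Scope classical_set_scope.
Local Open Scope ring_scope.

(* R^d is represented by [d.-tuple R], which carries the product (= Borel)
   sigma-algebra. *)

Definition eucl_dist (R : realType) (d : nat) (x y : d.-tuple R) : R :=
  Num.sqrt (\sum_(j < d) (tnth x j - tnth y j) ^+ 2).

Definition eucl_cball (R : realType) (d : nat) (x : d.-tuple R) (r : R) :
    set (d.-tuple R) :=
  [set y | eucl_dist x y <= r].

Definition eucl_lipschitz_on (R : realType) (d : nat) (c : R)
    (A : set (d.-tuple R)) (g : d.-tuple R -> R) : Prop :=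
  forall x y, A x -> A y -> `|g x - g y| <= c * eucl_dist x y.

(* The constants are taken nonnegative, so that a smallest one exists even when
   [V `&` S] has at most one point; it is a minimum as soon as [g] is Lipschitz
   on [V `&` S]. *)
Definition local_lipschitz_const (R : realType) (d : nat) (S : set (d.-tuple R))
    (g : d.-tuple R -> R) (V : set (d.-tuple R)) : R :=
  inf [set c : R | 0 <= c /\ eucl_lipschitz_on c (V `&` S) g].

Definition count_in (R : realType) (d n : nat) (xs : 'I_n -> d.-tuple R)
    (V : set (d.-tuple R)) : R :=
  \sum_(i < n) \1_V (xs i).

(* For [1 <= k <= n] the infimum is attained, unless at least [k] sample points
   coincide with [x]; the radius is then [0] and the ball is [[set x]]. *)
Definition knn_radius (R : realType) (d n k : nat) (xs : 'I_n -> d.-tuple R)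
    (x : d.-tuple R) : R :=
  inf [set tau : R | 0 < tau /\ k%:R <= count_in xs (eucl_cball x tau)].

Definition knn_map (R : realType) (d n k : nat) (xs : 'I_n -> d.-tuple R)
    (x : d.-tuple R) : set (d.-tuple R) :=
  eucl_cball x (knn_radius k xs x).

Definition local_average (R : realType) (d n : nat) (xs : 'I_n -> d.-tuple R)
    (ys : 'I_n -> R) (V : d.-tuple R -> set (d.-tuple R)) (x : d.-tuple R) :
    R :=
  (\sum_(i < n) ys i * \1_(V x) (xs i)) / count_in xs (V x).

Definition mutually_independent (disp disp' : measure_display)
    (Omega : measurableType disp) (T : measurableType disp') (R : realType)
    (P : probability Omega R) (I : finType) (Z : I -> Omega -> T) : Prop :=
  forall (J : {set I}) (A : I -> set T), (forall i, measurable (A i)) ->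
    P (\bigcap_(i in [set i | i \in J]) (Z i @^-1` A i)) =
    (\prod_(i in J) P (Z i @^-1` A i))%E.

Definition identically_distributed (disp disp' : measure_display)
    (Omega : measurableType disp) (T : measurableType disp') (R : realType)
    (P : probability Omega R) (I : finType) (Z : I -> Omega -> T) : Prop :=
  forall (i j : I) (A : set T), measurable A ->
    P (Z i @^-1` A) = P (Z j @^-1` A).

Definition iid (disp disp' : measure_display)
    (Omega : measurableType disp) (T : measurableType disp') (R : realType)
    (P : probability Omega R) (I : finType) (Z : I -> Omega -> T) : Prop :=
  mutually_independent P Z /\ identically_distributed P Z.

(* [h] is a version of [x |-> E[W | X = x]]; equivalently, [h \o X] is a version
   of [E[W | X]]. The sets [X @^-1` A] are exactly the events of sigma(X). *)
Definition is_condexp (disp disp' : measure_display)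
    (Omega : measurableType disp) (T : measurableType disp') (R : realType)
    (P : probability Omega R) (X : Omega -> T) (W : Omega -> R) (h : T -> R) :
    Prop :=
  [/\ P.-integrable setT (EFin \o W),
      measurable_fun setT h &
      forall A : set T, measurable A ->
        (\int[P]_(w in X @^-1` A) (W w)%:E =
         \int[P]_(w in X @^-1` A) (h (X w))%:E)%E].

Definition cond_subgaussian (disp disp' : measure_display)
    (Omega : measurableType disp) (T : measurableType disp') (R : realType)
    (P : probability Omega R) (X : Omega -> T) (eps : Omega -> R) (sigma : R) :
    Prop :=
  is_condexp P X eps (fun=> 0) /\
  forall s : R, exists2 h : T -> R,
    is_condexp P X (fun w => expR (s * eps w)) h &
    {ae P, forall w, h (X w) <= expR (s ^+ 2 * sigma ^+ 2 / 2)}.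

(* [E] need not be measurable (it typically quantifies over uncountably many
   points), hence the measurable event inside it. *)
Definition with_probability_at_least (disp : measure_display)
    (Omega : measurableType disp) (R : realType) (P : probability Omega R)
    (p : R) (E : set Omega) : Prop :=
  exists A : set Omega, [/\ measurable A, (p%:E <= P A)%E & A `<=` E].

(* Main.v *)
(* Closed balls cut at most (m + 1)^(d+1) subsets out of m points: lifting x to
   (|x|^2, x) turns balls into half-spaces whose normal has first coordinate 1, so
   they shatter at most d + 1 points, and Sauer-Shelah applies.

   Noise: given the design, Chernoff's bound controls the sum of the noises over
   each set of indices J that a ball cuts out; since the expected number of such J
   is at most (n + 1)^(d+1), the union bound costs only that factor. The set of
   balls enters through the events "J is cut out by a ball with rational
   parameters", which are measurable.

   Radius: if a ball of mass at least 2k/n contained fewer than k sample points, then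
   the expectation over a ghost sample of
   sum_J (2/3)^(#J in the sample) (4/3)^(#J in the ghost sample),
   J ranging over the traces of balls on both samples, would be at least
   (2/3)^k (4/3)^(2k) = (32/27)^k >= exp(k/8). Exchanging the two samples
   coordinate by coordinate shows that its mean is at most (2n + 1)^(d+1), and
   Markov's inequality concludes. *)

Require Import Defs.
From HB Require Import structures.
From mathcomp Require Import all_boot all_order all_algebra.
From mathcomp Require Import all_fingroup.
From mathcomp Require Import all_classical all_reals all_analysis.
From mathcomp Require Import measurable_realfun.
From mathcomp Require Import ring lra.

Set Implicit Arguments.
Unset Strict Implicit.
Unset Printing Implicit Defensive.

Import Order.TTheory GRing.Theory Num.Theory.

(** * Sauer-Shelah *)

Definition shatters (I : finType) (F : {set {set I}}) (K : {set I}) : bool :=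
  [forall A : {set I}, (A \subset K) ==> [exists B in F, B :&: K == A]].

Lemma shattersP (I : finType) (F : {set {set I}}) (K : {set I}) :
  reflect (forall A : {set I}, A \subset K -> exists2 B, B \in F & B :&: K = A)
          (shatters F K).
Proof.
apply: (iffP forallP) => H A.
  by move=> AK; have /implyP/(_ AK)/exists_inP[B BF /eqP] := H A; exists B.
apply/implyP => AK; have [B BF BK] := H A AK.
by apply/exists_inP; exists B => //; apply/eqP.
Qed.

(** Pajor's form of Sauer-Shelah, by induction on [#|F|]: split [F] by membership of a point on
    which two members disagree, and add up the sets that the two halves shatter. *)
Lemma leq_card_shatters (I : finType) (F : {set {set I}}) :
  #|F| <= #|[set K | shatters F K]%SET|.
Proof.
have [m] := ubnP #|F|; elim: m F => // m IH F Fm.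
have [F1|F2] := leqP #|F| 1.
  case: (posnP #|F|) => [->//|/card_gt0P[B FB]].
  apply: (leq_trans F1); rewrite card_gt0; apply/set0Pn; exists finset.set0.
  rewrite finset.inE; apply/shattersP => A; rewrite finset.subset0 => /eqP->.
  by exists B; rewrite // finset.setI0.
have [A [B [FA FB AB]]] := card_gt1P F2.
(* Both halves contain [A] or [B], so both are nonempty, hence strictly smaller than [F]. *)
have [x xAB] : exists x, (x \in A) != (x \in B).
  apply/existsP; apply: contraNT AB => /existsPn AB.
  by apply/eqP/setP => x; apply/eqP; have := AB x; rewrite negbK.
pose F' b := [set C in F | (x \in C) == b]%SET.
have cF : #|F| = #|F' true| + #|F' false|.
  rewrite -cardsUI [X in _ + X](_ : _ = 0) ?addn0; last first.
    apply/eqP; rewrite cards_eq0; apply/eqP/setP => C.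
    by rewrite !finset.inE; case: (C \in F); case: (x \in C).
  by apply: eq_card => C; rewrite !finset.inE; case: (C \in F); case: (x \in C).
have F'0 b : 0 < #|F' b|.
  apply/card_gt0P; exists (if (x \in A) == b then A else B).
  rewrite finset.inE; case: ifP => [->|]; first by rewrite FA.
  by rewrite FB; move: xAB; case: (x \in A); case: (x \in B); case: b.
(* A set shattered by both halves is shattered by F with and without x. *)
have {}IH b : #|F' b| <= #|[set K | shatters (F' b) K]%SET|.
  apply: IH; rewrite -ltnS (leq_trans _ Fm)// ltnS cF.
  have := F'0 true; have := F'0 false; case: b => H1 H2.
    by rewrite -addn1 leq_add2l.
  by rewrite -add1n leq_add2r.
(* All members of a half agree on [x], so none of the sets they shatter can contain it. *)
have xnotin b K : shatters (F' b) K -> x \notin K.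
  move=> /shattersP sh; apply/negP => xK.
  have [|C] := sh (if b then finset.set0 else K).
    by case: (b); rewrite ?finset.sub0set.
  rewrite finset.inE => /andP[_ /eqP xC] /setP /(_ x).
  by rewrite finset.inE xC xK; case: b {xC sh}; rewrite ?finset.inE ?xK.
pose sh b := [set K | shatters (F' b) K]%SET.
(* A set counted in both halves needs a second witness: [G] provides it by adding [x]. By [xnotin]
   these witnesses are new. *)
pose G := [set x |: K | K in sh true :&: sh false]%SET.
have cG : #|G| = #|sh true :&: sh false|.
  apply: card_in_imset => K1 K2; rewrite !finset.inE => /andP[+ _] /andP[+ _].
  move=> /xnotin xK1 /xnotin xK2 /(congr1 (fun K => K :\ x)).
  by rewrite !finset.setU1K.
have dG : G :&: (sh true :|: sh false) = finset.set0.
  apply/setP => K; rewrite !finset.inE; apply/negbTE/andP.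
  move=> [/imsetP[K' _ ->]] /orP[] /xnotin; rewrite !finset.inE eqxx //.
rewrite cF (leq_trans (leq_add (IH true) (IH false)))// -cardsUI -/(sh _).
rewrite -/(sh false) -cG addnC -cardsUI dG cards0 addn0 subset_leq_card//.
apply/fintype.subsetP => K; rewrite !finset.inE => /orP[/imsetP[K']|].
  rewrite !finset.inE => /andP[sht shf] ->; apply/shattersP => C CK.
  have xK' := xnotin _ _ sht.
  have CxK' : C :\ x \subset K'.
    by rewrite finset.subDset (fintype.subset_trans CK).
  have [D] : exists2 D, D \in F' (x \in C) & D :&: K' = C :\ x.
    by case: (x \in C); apply/shattersP: CxK'.
  rewrite finset.inE => /andP[FD /eqP xD] DK; exists D => //.
  apply/setP => y; have /setP/(_ y) := DK.
  by rewrite !finset.inE; have [->|_]/= := eqVneq y x; rewrite ?andbT.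
have mono b : shatters (F' b) K -> shatters F K.
  move=> /shattersP s; apply/shattersP => C /s[D DF <-].
  by exists D => //; move: DF; rewrite finset.inE => /andP[].
by move=> /orP[] /mono.
Qed.

Lemma card_set_le (I : finType) (D : nat) :
  #|[set K : {set I} | #|K| <= D]%SET| <= #|I|.+1 ^ D.
Proof.
pose f (u : {ffun 'I_D -> option I}) : {set I} :=
  [set x | Some x \in codom u]%SET.
have -> : #|I|.+1 ^ D = #|{ffun 'I_D -> option I}|.
  by rewrite card_ffun card_option card_ord.
rewrite (leq_trans _ (leq_imset_card f _))//.
apply/subset_leq_card/fintype.subsetP => K; rewrite finset.inE => KD.
apply/imsetP; exists [ffun i : 'I_D => nth None (map some (enum K)) i] => //.
apply/setP => x; rewrite finset.inE; apply/idP/codomP => [xK|[i]].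
  have ix : index x (enum K) < size (enum K) by rewrite index_mem mem_enum.
  have iD : index x (enum K) < D by rewrite (leq_trans ix)// -cardE.
  exists (Ordinal iD).
  by rewrite ffunE (nth_map x)//= nth_index// mem_enum.
rewrite ffunE => e.
have := mem_nth None (_ : i < size (map some (enum K))).
have [iK /(_ isT)|iK] := ltnP i (size (map some (enum K))).
  by rewrite -e mem_map ?mem_enum// => ? ? [].
by rewrite nth_default in e.
Qed.

Lemma sauer_shelah (I : finType) (F : {set {set I}}) (D : nat) :
  (forall K, shatters F K -> #|K| <= D) -> #|F| <= #|I|.+1 ^ D.
Proof.
move=> H; rewrite (leq_trans (leq_card_shatters F))//.
rewrite (leq_trans _ (card_set_le _ _))//.
by apply/subset_leq_card/fintype.subsetP => K; rewrite !finset.inE; exact: H.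
Qed.

Local Open Scope classical_set_scope.
Local Open Scope ring_scope.

(** * Traces of balls *)

(** A half-space in dimension D + 1 whose coefficient along [b] is fixed, so that only D parameters
    vary. Strictness on both sides leaves room to perturb [t]. *)
Definition affinely_cut (R : realFieldType) (D : nat) (I : finType)
    (v : I -> 'rV[R]_D) (b : I -> R) (J : {set I}) (t : 'cV[R]_D) : Prop :=
  forall i, if i \in J then b i < (v i *m t) 0 0 else (v i *m t) 0 0 < b i.

(** Radon's argument: more than D rows [v i] satisfy a nontrivial linear relation [u]. Cutting out
    the positive supports of [u] and of [- u] makes the sum of [u i * b i] both negative and
    positive. *)
Lemma affinely_cut_shatters (R : realFieldType) (D : nat) (I : finType)
    (v : I -> 'rV[R]_D) (b : I -> R) (F : {set {set I}}) (K : {set I}) :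
  (forall J, J \in F -> exists t, affinely_cut v b J t) ->
  shatters F K -> (#|K| <= D)%N.
Proof.
move=> HF /shattersP sh; rewrite leqNgt; apply/negP => DK.
pose A := \matrix_(i < #|K|) v (enum_val i).
have kerA0 : kermx A != 0.
  rewrite -mxrank_eq0 mxrank_ker subn_eq0 -ltnNge.
  by rewrite (leq_ltn_trans _ DK)// rank_leq_col.
have /rowV0Pn[u0 /sub_kermxP u0A u0n0] := kerA0.
(* A cut of {u > 0} makes every term u_i (b_i - v_i t) nonpositive, while the
   sum of these terms does not depend on t. *)
have key (u : 'rV[R]_#|K|) : u *m A = 0 -> u != 0 ->
    \sum_i u 0 i * b (enum_val i) < 0.
  move=> uA un0.
  have [|J JF JK] := sh [set enum_val i | i in [pred i | 0 < u 0 i]]%SET.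
    by apply/fintype.subsetP => x /imsetP[i _ ->]; exact: enum_valP.
  have [t cut] := HF J JF.
  have inJ i : (enum_val i \in J) = (0 < u 0 i).
    have := congr1 (fun B : {set I} => enum_val i \in B) JK.
    rewrite inE enum_valP andbT => ->; apply/imsetP/idP => [[j +]|ui].
      by move=> + /enum_val_inj ->; rewrite inE.
    by exists i.
  have -> : \sum_i u 0 i * b (enum_val i) =
      \sum_i u 0 i * (b (enum_val i) - (v (enum_val i) *m t) 0 0).
    under [RHS]eq_bigr do rewrite mulrBr.
    rewrite sumrB.
    have <- : (u *m A *m t) 0 0 = \sum_i u 0 i * (v (enum_val i) *m t) 0 0.
      rewrite -mulmxA mxE; apply: eq_bigr => i _; congr (_ * _).
      by rewrite [in RHS]mxE mxE; apply: eq_bigr => l _; rewrite !mxE.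
    by rewrite uA mul0mx mxE subr0.
  have le0 i : u 0 i * (b (enum_val i) - (v (enum_val i) *m t) 0 0) <= 0.
    have := cut (enum_val i); rewrite inJ; case: ltP => u0' H.
      by rewrite pmulr_rle0// subr_le0 ltW.
    by rewrite mulr_le0_ge0// subr_ge0 ltW.
  (* The cut is strict, so a nonzero entry of [u] gives a strictly negative term. *)
  have [i ui] : exists i, u 0 i != 0.
    by apply/existsP; apply: contraNT un0 => /existsPn H; apply/eqP/rowP => i;
      have := H i; rewrite negbK mxE => /eqP.
  rewrite (bigD1 i)//= ltr_wnDr ?sumr_le0//.
  have := cut (enum_val i); rewrite inJ; case: ltP => u0' H.
    by rewrite pmulr_rlt0// subr_lt0.
  by rewrite nmulr_rlt0 ?subr_gt0// lt_neqAle ui.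
have := key u0 u0A u0n0.
have : \sum_i (- u0) 0 i * b (enum_val i) < 0.
  by apply: key; rewrite ?oppr_eq0// mulNmx u0A oppr0.
under eq_bigr do rewrite mxE mulNr.
by rewrite sumrN oppr_lt0 => /lt_trans h/h; rewrite ltxx.
Qed.

Lemma card_affinely_cut (R : realFieldType) (D : nat) (I : finType)
    (v : I -> 'rV[R]_D) (b : I -> R) (F : {set {set I}}) :
  (forall J, J \in F -> exists t, affinely_cut v b J t) ->
  (#|F| <= #|I|.+1 ^ D)%N.
Proof.
by move=> HF; apply: sauer_shelah => K; exact: affinely_cut_shatters HF.
Qed.

(** A common slack for finitely many strict inequalities. Halving the minimum makes it strict, and
    the default 1 covers the case of no positive [a i]. *)
Lemma fin_lt_pos (R : realFieldType) (I : finType) (a : I -> R) :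
  exists2 e, 0 < e & forall i, 0 < a i -> e < a i.
Proof.
have m0 : 0 < \big[Num.min/1]_(i | 0 < a i) a i by apply: lt_bigmin.
exists (\big[Num.min/1]_(i | 0 < a i) a i / 2); first by rewrite divr_gt0.
move=> i ai; apply: (@lt_le_trans _ _ (\big[Num.min/1]_(i | 0 < a i) a i)).
  by rewrite ltr_pdivrMr// ltr_pMr// ltr1n.
exact: bigmin_le_cond.
Qed.

(** Finitely many strict inequalities survive a small move of [t]. Rational parameters will turn the
    existence of a cut into a countable union of events. *)
Lemma affinely_cut_rat (R : realType) (D : nat) (I : finType)
    (v : I -> 'rV[R]_D) (b : I -> R) (J : {set I}) (t : 'cV[R]_D) :
  affinely_cut v b J t ->
  exists q : 'cV[rat]_D, affinely_cut v b J (map_mx ratr q).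
Proof.
(* Moving each coordinate of [t] by at most [e] moves [v i *m t] by at most [e * N i]; the added 1
   keeps [N i] positive when [v i] is 0. *)
move=> cut; pose N i := \sum_l `|v i 0 l| + 1.
have N0 i : 0 < N i by rewrite ltr_wpDl// sumr_ge0.
pose c i := b i - (v i *m t) 0 0.
have c0 i : c i != 0.
  by have := cut i; case: ifP => _; rewrite subr_eq0 => H; [rewrite lt_eqF|rewrite gt_eqF].
have [e e0 He] := fin_lt_pos (fun i => `|c i| / N i).
have /fin_all_exists[q Hq] (l : 'I_D) : exists q : rat, t l 0 < ratr q < t l 0 + e.
  have /rat_in_itvoo[q] : t l 0 < t l 0 + e by rewrite ltrDl.
  by rewrite in_itv/= => H; exists q.
exists (\col_l q l) => i.
have close : `|(v i *m map_mx ratr (\col_l q l)) 0 0 - (v i *m t) 0 0| < `|c i|.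
  have -> : (v i *m map_mx ratr (\col_l q l)) 0 0 - (v i *m t) 0 0 =
      \sum_l v i 0 l * (ratr (q l) - t l 0).
    by rewrite !mxE -sumrB; apply: eq_bigr => l _; rewrite !mxE mulrBr.
  apply: (@le_lt_trans _ _ (e * N i)); last first.
    by rewrite -ltr_pdivlMr// He// divr_gt0// normr_gt0.
  rewrite (le_trans (ler_norm_sum _ _ _))// /N mulrDr mulr_sumr mulr1.
  rewrite -[leLHS]addr0 lerD ?(ltW e0)//.
  apply: ler_sum => l _.
  rewrite normrM mulrC ler_wpM2r//.
  by have := Hq l; rewrite ler_norml => /andP[]; lra.
have := cut i; rewrite /c in close.
case: ifP => _ H.
  by move: close; rewrite (ltr0_norm (_ : b i - _ < 0)) ?subr_lt0// ltr_norml; lra.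
by move: close; rewrite (gtr0_norm (_ : 0 < b i - _)) ?subr_gt0// ltr_norml; lra.
Qed.

Section lifting.
Variables (R : realType) (d : nat).
Implicit Types x c : d.-tuple R.

(** The row (1, x). The constant coordinate carries the offset r^2 - |c|^2 of a ball; the coordinate
    |x|^2 of the lifting is the [b] of [affinely_cut]. *)
Definition affine_lift x : 'rV[R]_d.+1 :=
  \row_l oapp (tnth x) 1 (unlift ord0 l).

Definition sqnorm x : R := \sum_(j < d) tnth x j ^+ 2.

Lemma eucl_dist_ge0 x c : 0 <= eucl_dist x c.
Proof. exact: sqrtr_ge0. Qed.

Lemma affine_liftE x (t : 'cV[R]_d.+1) :
  (affine_lift x *m t) 0 0 = t 0 0 + \sum_j tnth x j * t (lift ord0 j) 0.
Proof.
rewrite mxE big_ord_recl mxE unlift_none/= mul1r; congr (_ + _).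
by apply: eq_bigr => j _; rewrite mxE liftK.
Qed.

Lemma eucl_dist_sqr x c : eucl_dist c x ^+ 2 =
  sqnorm x + sqnorm c - 2 * \sum_j tnth x j * tnth c j.
Proof.
rewrite sqr_sqrtr ?sumr_ge0// => [|j _]; last exact: sqr_ge0.
rewrite /sqnorm mulr_sumr -big_split -sumrB/=.
by apply: eq_bigr => j _; ring.
Qed.

(** Expanding the square, |x - c|^2 <= r^2 reads |x|^2 <= 2 <x, c> + r^2 - |c|^2, which is affine in
    x on the right. *)
Lemma ball_affinely_cut (I : finType) (xs : I -> d.-tuple R) c r :
  0 <= r ->
  exists t, affinely_cut (affine_lift \o xs) (sqnorm \o xs)
    [set i | eucl_dist c (xs i) <= r]%SET t.
Proof.
move=> r0.
(* Enlarging r^2 by less than the gap to the nearest outside point makes the cut strict for points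
   on the sphere. *)
have [e e0 He] := fin_lt_pos (fun i => eucl_dist c (xs i) ^+ 2 - r ^+ 2).
pose t : 'cV[R]_d.+1 := \col_l oapp (fun j => 2 * tnth c j)
   (r ^+ 2 + e - sqnorm c) (unlift ord0 l).
exists t => i; rewrite inE/=.
have -> : (affine_lift (xs i) *m t) 0 0 =
    sqnorm (xs i) + (r ^+ 2 + e - eucl_dist c (xs i) ^+ 2).
  rewrite affine_liftE mxE unlift_none/= eucl_dist_sqr.
  under eq_bigr do rewrite mxE liftK/=.
  have -> : \sum_(i0 < d) tnth (xs i) i0 * (2 * tnth c i0) =
     2 * \sum_(i0 < d) tnth (xs i) i0 * tnth c i0.
    by rewrite mulr_sumr; apply: eq_bigr => j _; ring.
  by ring.
rewrite /comp; have := eucl_dist_ge0 c (xs i).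
case: (leP (eucl_dist c (xs i)) r) => h h0.
  have H : eucl_dist c (xs i) ^+ 2 <= r ^+ 2 by rewrite ler_pXn2r ?nnegrE.
  by lra.
have H : 0 < eucl_dist c (xs i) ^+ 2 - r ^+ 2 by rewrite subr_gt0 ltr_pXn2r ?nnegrE.
by have := He _ H; lra.
Qed.

(** Completing the square, [J] is the set of points in an open ball, possibly empty, with rational
    data and no point of [xs] on its boundary equation. *)
Definition ball_trace (I : finType) (J : {set I}) (xs : I -> d.-tuple R) : Prop :=
  exists q : 'cV[rat]_d.+1,
    affinely_cut (affine_lift \o xs) (sqnorm \o xs) J (map_mx ratr q).

Lemma ball_traceP (I : finType) (xs : I -> d.-tuple R) c r :
  0 <= r -> ball_trace [set i | eucl_dist c (xs i) <= r]%SET xs.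
Proof. by move=> r0; have [t] := ball_affinely_cut xs c r0; exact: affinely_cut_rat. Qed.

Lemma card_ball_trace (I : finType) (xs : I -> d.-tuple R) :
  (#|[set J : {set I} | `[< ball_trace J xs >] ]%SET| <= #|I|.+1 ^ d.+1)%N.
Proof.
apply: (@card_affinely_cut _ _ _ (affine_lift \o xs) (sqnorm \o xs)) => J.
by rewrite finset.inE => /asboolP[q cut]; exists (map_mx ratr q).
Qed.

End lifting.

(** * Measurability of ball traces *)

Lemma measurable_set_ltr (R : realType) (dO : measure_display)
    (O : measurableType dO) (f g : O -> R) :
  measurable_fun setT f -> measurable_fun setT g ->
  measurable [set w | f w < g w].
Proof.
move=> mf mg; have := measurable_fun_ltr mf mg measurableT.
by move=> /(_ [set true] I); rewrite setTI preimage_true.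
Qed.

Lemma measurable_ball_trace (R : realType) (d : nat) (dO : measure_display)
    (O : measurableType dO) (I : finType) (J : {set I})
    (xs : I -> O -> d.-tuple R) :
  (forall i, measurable_fun setT (xs i)) ->
  measurable [set w | ball_trace J (xs ^~ w)].
Proof.
move=> mx.
have mtx i j : measurable_fun setT (fun w => tnth (xs i w) j).
  by apply: (measurableT_comp (measurable_tnth j)); exact: mx.
have -> : [set w | ball_trace J (xs ^~ w)] =
  \bigcup_(q : 'cV[rat]_d.+1) \big[setI/setT]_(i : I)
    [set w | if i \in J
      then sqnorm (xs i w) < (affine_lift (xs i w) *m map_mx ratr q) 0 0
      else (affine_lift (xs i w) *m map_mx ratr q) 0 0 < sqnorm (xs i w)].
  apply/seteqP; split=> w /=.
    move=> [q cut]; exists q => //.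
    by rewrite -bigcap_seq/= => i _; exact: cut.
  move=> [q _]; rewrite -bigcap_seq/= => cut; exists q => i.
  by apply: cut; rewrite /= mem_index_enum.
apply: countable_bigcupT_measurable => //.
move=> q; apply: bigsetI_measurable => i _.
have m1 : measurable_fun setT (fun w => sqnorm (xs i w)).
  by apply: measurable_sum => j; exact: measurable_funX.
have m2 : measurable_fun setT
    (fun w => (affine_lift (xs i w) *m map_mx ratr q) 0 0).
  under eq_fun do rewrite affine_liftE.
  apply: measurable_funD => //; apply: measurable_sum => j.
  exact: measurable_funM.
by case: (i \in J); exact: measurable_set_ltr.
Qed.

(** * Independent copies *)

Section tuples_of_functions.
Context d1 dT (O1 : measurableType d1) (T : measurableType dT) (m : nat).

Lemma measurable_tuple_box (A : 'I_m -> set T) :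
  (forall i, measurable (A i)) ->
  measurable [set t : m.-tuple T | forall i, A i (tnth t i)].
Proof.
move=> mA.
rewrite (_ : [set t | _] = \big[setI/setT]_(i < m) ((@tnth _ T)^~ i @^-1` A i)).
  apply: bigsetI_measurable => i _; rewrite -[X in measurable X]setTI.
  exact: measurable_tnth.
apply/seteqP; split => t /= h; first by rewrite -bigcap_seq => i _; exact: h.
move=> i; move: h; rewrite -bigcap_seq; apply.
by rewrite /= mem_index_enum.
Qed.

(** Boxes, unlike preimages under single coordinates, are stable under intersection, as the
    uniqueness theorem for measures requires. *)
Lemma measurable_tupleE :
  @measurable _ (m.-tuple T) =
  <<s [set B | exists A : 'I_m -> set T,
    (forall i, measurable (A i)) /\ B = [set t | forall i, A i (tnth t i)]] >>.
Proof.
apply/seteqP; split; last first.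
  apply: smallest_sub; first exact: sigma_algebra_measurable.
  by move=> _ [A [mA ->]]; exact: measurable_tuple_box.
apply: smallest_sub; first exact: smallest_sigma_algebra.
move=> B; rewrite -bigcup_seq => -[i _] [C mC <-].
apply: sub_sigma_algebra; exists (fun j => if j == i then C else setT).
split=> [j|]; first by case: ifP.
apply/seteqP; split => t /=; first by move=> [_ Ct] j; case: eqP => // ->.
by move=> /(_ i); rewrite eqxx.
Qed.

Lemma measurable_mktuple (V : 'I_m -> O1 -> T) :
  (forall i, measurable_fun setT (V i)) ->
  measurable_fun setT (fun w => [tuple V i w | i < m]).
Proof.
move=> mV; apply/measurable_fun_tnthP => i; rewrite (_ : _ \o _ = V i)//.
by apply/funext => w /=; rewrite tnth_mktuple.
Qed.

Lemma tnth_mktuple_fun (g : 'I_m -> T) : tnth [tuple g i | i < m] = g.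
Proof. by apply/funext => i; rewrite tnth_mktuple. Qed.

Lemma measurable_fun_coords dE (E : measurableType dE) (V : 'I_m -> O1 -> T)
    (f : ('I_m -> T) -> E) :
  (forall i, measurable_fun setT (V i)) ->
  measurable_fun setT (fun t : m.-tuple T => f (tnth t)) ->
  measurable_fun setT (fun w => f (V ^~ w)).
Proof.
move=> /measurable_mktuple mv mf.
rewrite (_ : (fun w => _) = fun w => f (tnth [tuple V i w | i < m])).
  exact: (measurableT_comp mf mv).
by apply/funext => w; rewrite tnth_mktuple_fun.
Qed.

Lemma measurable_set_coords (V : 'I_m -> O1 -> T) (G : set ('I_m -> T)) :
  (forall i, measurable_fun setT (V i)) ->
  measurable [set t : m.-tuple T | G (tnth t)] ->
  measurable [set w | G (V ^~ w)].
Proof.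
move=> /measurable_mktuple mv mG.
rewrite -[X in measurable X]setTI.
rewrite (_ : [set w | _] = (fun w => [tuple V i w | i < m]) @^-1`
  [set t : m.-tuple T | G (tnth t)]); first exact: mv.
by apply/seteqP; split => w /=; rewrite tnth_mktuple_fun.
Qed.

End tuples_of_functions.

Section equality_of_laws.
Local Open Scope ereal_scope.
Context d1 d2 dT (O1 : measurableType d1) (O2 : measurableType d2)
  (T : measurableType dT) (R : realType) (m : nat).
Variables (m1 : {measure set O1 -> \bar R}) (m2 : {measure set O2 -> \bar R}).

(** Both sides integrate [f] against an image measure on tuples, and the two finite image measures
    agree on the pi-system of boxes. *)
Lemma eq_law_integral (U : 'I_m -> O1 -> T) (V : 'I_m -> O2 -> T)
    (f : ('I_m -> T) -> \bar R) :
  m1 setT < +oo ->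
  (forall i, measurable_fun setT (U i)) ->
  (forall i, measurable_fun setT (V i)) ->
  (forall A : 'I_m -> set T, (forall i, measurable (A i)) ->
    m1 [set w | forall i, A i (U i w)] = m2 [set w | forall i, A i (V i w)]) ->
  measurable_fun setT (fun t : m.-tuple T => f (tnth t)) ->
  (forall t, 0 <= f t) ->
  \int[m1]_w f (U ^~ w) = \int[m2]_w f (V ^~ w).
Proof.
move=> m1fin mU mV UV mf f0.
pose u w : m.-tuple T := [tuple U i w | i < m].
pose v w : m.-tuple T := [tuple V i w | i < m].
have mu : measurable_fun setT u := measurable_mktuple mU.
have mv : measurable_fun setT v := measurable_mktuple mV.
pose u' : {mfun O1 >-> m.-tuple T} := mfun_Sub (mem_set mu).
pose v' : {mfun O2 >-> m.-tuple T} := mfun_Sub (mem_set mv).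
have fu w : f (U ^~ w) = f (tnth (u w)) by rewrite tnth_mktuple_fun.
have fv w : f (V ^~ w) = f (tnth (v w)) by rewrite tnth_mktuple_fun.
under eq_integral do rewrite fu.
under [RHS]eq_integral do rewrite fv.
rewrite -[LHS](@ge0_integral_pushforward _ _ _ _ _ _ mu m1 setT (fun t => f (tnth t)))//.
rewrite -[RHS](@ge0_integral_pushforward _ _ _ _ _ _ mv m2 setT (fun t => f (tnth t)))//.
apply: (@eq_measure_integral _ _ _ _ (pushforward m2 v') (pushforward m1 u')).
move=> B mB _.
apply: (@measure_unique _ _ _ _ (fun=> setT) (@measurable_tupleE _ T m) _ _ _
   (pushforward m1 u') (pushforward m2 v')) => //.
- move=> _ _ [A [mA ->]] [A' [mA' ->]].
  exists (fun i => A i `&` A' i); split; first by move=> i; exact: measurableI.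
  apply/seteqP; split => t /=; first by move=> [h h'] i.
  by move=> h; split => i; have [] := h i.
- move=> _; exists (fun=> setT); split=> //.
  by apply/seteqP; split.
- by apply/seteqP; split => // t _; exists 0%N.
- move=> _ [A [mA ->]].
  have := UV A mA; rewrite /pushforward.
  rewrite (_ : [set w | _] = u' @^-1` [set t | forall i, A i (tnth t i)]).
    rewrite (_ : [set w | _] = v' @^-1` [set t | forall i, A i (tnth t i)])//.
    by apply/seteqP; split => w /= h i; have := h i; rewrite tnth_mktuple.
  by apply/seteqP; split => w /= h i; have := h i; rewrite tnth_mktuple.
Qed.

End equality_of_laws.

(** Stated for a measure [m] so as to apply to [P \x P] too. Full boxes suffice: sides equal to
    [setT] give subfamilies, and total mass 1. *)
Definition iid_law d dT (O : measurableType d) (T : measurableType dT)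
    (R : realType) (n : nat) (m : {measure set O -> \bar R})
    (Z : 'I_n -> O -> T) (mu : probability T R) : Prop :=
  (forall i, measurable_fun setT (Z i)) /\
  forall A : 'I_n -> set T, (forall i, measurable (A i)) ->
    m [set w | forall i, A i (Z i w)] = (\prod_(i < n) mu (A i))%E.

Lemma measurable_box_in d dT (O : measurableType d) (T : measurableType dT)
    (I : finType) (J : pred I) (Z : I -> O -> T) (A : I -> set T) :
  (forall i, measurable_fun setT (Z i)) -> (forall i, measurable (A i)) ->
  measurable [set w | forall i, J i -> A i (Z i w)].
Proof.
move=> mZ mA.
rewrite (_ : [set w | _] = \big[setI/setT]_(i | J i) (Z i @^-1` A i)).
  apply: bigsetI_measurable => i _; rewrite -[X in measurable X]setTI.
  exact: mZ.
apply/seteqP; split => w /=.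
  by move=> h; rewrite -bigcap_seq_cond => i /= /andP[_ /h].
by rewrite -bigcap_seq_cond => h i Ji; apply: h; rewrite /= mem_index_enum.
Qed.

Lemma measurable_box d dT (O : measurableType d) (T : measurableType dT)
    (I : finType) (Z : I -> O -> T) (A : I -> set T) :
  (forall i, measurable_fun setT (Z i)) -> (forall i, measurable (A i)) ->
  measurable [set w | forall i, A i (Z i w)].
Proof.
move=> mZ mA; have := measurable_box_in xpredT mZ mA.
by congr measurable; apply/seteqP; split => w /= h i; [exact: h|move=> _; exact: h].
Qed.

Section iid_law.
Local Open Scope ereal_scope.
Context d dT (O : measurableType d) (T : measurableType dT) (R : realType).
Variable (mu : probability T R).

Lemma iid_law_setT n (m : {measure set O -> \bar R}) (Z : 'I_n -> O -> T) :
  iid_law m Z mu -> m setT = 1.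
Proof.
move=> [_ /(_ (fun=> setT) (fun=> measurableT))].
rewrite big1 => [<-|i _]; last exact: probability_setT.
by congr (m _); apply/seteqP; split.
Qed.

Lemma iid_law_subset n (m : {measure set O -> \bar R}) (Z : 'I_n -> O -> T)
    (J : pred 'I_n) (A : 'I_n -> set T) :
  iid_law m Z mu -> (forall i, measurable (A i)) ->
  m [set w | forall i, J i -> A i (Z i w)] = \prod_(i < n | J i) mu (A i).
Proof.
move=> [_ H] mA; pose A' i := if J i then A i else setT.
have -> : \prod_(i < n | J i) mu (A i) = \prod_(i < n) mu (A' i).
  rewrite [RHS](bigID J)/= [X in _ * X]big1 ?mule1 => [|i]; last first.
    by rewrite /A' => /negbTE ->; exact: probability_setT.
  by apply: eq_bigr => i; rewrite /A' => ->.
rewrite -H => [|i]; last by rewrite /A'; case: ifP.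
congr (m _); apply/seteqP; split => w /= h i; have := h i; rewrite /A'.
  by case: ifP => // _; apply.
by move=> + Ji; rewrite Ji.
Qed.

Lemma iid_law_marginal n (m : {measure set O -> \bar R}) (Z : 'I_n -> O -> T)
    (i : 'I_n) (A : set T) :
  iid_law m Z mu -> measurable A -> m (Z i @^-1` A) = mu A.
Proof.
move=> H mA; have := iid_law_subset (pred1 i) H (fun=> mA).
rewrite big_pred1_eq => <-.
by congr (m _); apply/seteqP; split => w /= h => [j /eqP ->|]//; exact: h.
Qed.

Lemma iid_law_perm n (m : {measure set O -> \bar R}) (Z : 'I_n -> O -> T)
    (s : {perm 'I_n}) :
  iid_law m Z mu -> iid_law m (Z \o s) mu.
Proof.
move=> [mZ H]; split => [i|A mA]; first exact: mZ.
rewrite (reindex_inj (@perm_inj _ (s^-1)%g))/= -H => [|i]; last exact: mA.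
congr (m _); apply/seteqP; split => w /= h i.
  by have := h ((s^-1)%g i); rewrite permKV.
by have := h (s i); rewrite permK.
Qed.

Lemma iid_law_integral_perm n (m : {measure set O -> \bar R})
    (Z : 'I_n -> O -> T) (s : {perm 'I_n}) (f : ('I_n -> T) -> \bar R) :
  iid_law m Z mu ->
  measurable_fun setT (fun t : n.-tuple T => f (tnth t)) ->
  (forall t, 0 <= f t) ->
  \int[m]_w f (Z ^~ w) = \int[m]_w f (fun i => Z (s i) w).
Proof.
move=> H mf f0; have [mZ' H'] := iid_law_perm s H.
apply: (@eq_law_integral _ _ _ _ _ _ _ _ m m Z (Z \o s)) => //.
- by rewrite (iid_law_setT H) ltry.
- exact: H.1.
- by move=> A mA; rewrite (H.2 A mA) (H' A mA).
Qed.

Variable P : probability O R.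

Definition ghost n (Z : 'I_n -> O -> T) (j : 'I_(n + n)) (ww : O * O) : T :=
  match fintype.split j with
  | inl i => Z i ww.1
  | inr i => Z i ww.2
  end.

Lemma iid_law_ghost n (Z : 'I_n -> O -> T) :
  iid_law P Z mu -> iid_law (P \x P) (ghost Z) mu.
Proof.
move=> [mZ H]; split => [j|A mA].
  rewrite /ghost; case: fintype.split => i.
    exact: (measurableT_comp (mZ i) measurable_fst).
  exact: (measurableT_comp (mZ i) measurable_snd).
rewrite big_split_ord/= -!H; try by move=> i; exact: mA.
rewrite -product_measure1E.
- congr ((P \x P) _); apply/seteqP; split => -[w w'] /=.
    move=> h; split => i /=.
      by have := h (lshift n i); rewrite /ghost -[lshift n i]/(unsplit (inl i)) unsplitK.
    by have := h (rshift n i); rewrite /ghost -[rshift n i]/(unsplit (inr i)) unsplitK.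
  move=> [h h'] j; rewrite /ghost -[in A j](splitK j).
  by case: fintype.split => i; [exact: h|exact: h'].
- by apply: (measurable_box (A := A \o lshift n)) => // i; exact: mA.
- by apply: (measurable_box (A := fun i : 'I_n => A (rshift n i))).
Qed.

(** This replaces conditioning on the other coordinates: redrawing coordinate [i] on an independent
    copy of the space preserves the joint law, and Tonelli then splits the integral. *)
Lemma iid_law_decouple n (Z : 'I_n -> O -> T) (i : 'I_n)
    (f : ('I_n -> T) -> \bar R) :
  iid_law P Z mu ->
  measurable_fun setT (fun t : n.-tuple T => f (tnth t)) ->
  (forall t, 0 <= f t) ->
  \int[P]_w f (Z ^~ w) =
  \int[P]_w \int[P]_w' f (fun j => if j == i then Z j w' else Z j w).
Proof.
move=> H mf f0; have [mZ _] := H.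
pose V (j : 'I_n) (ww : O * O) := if j == i then Z j ww.2 else Z j ww.1.
have mV j : measurable_fun setT (V j).
  rewrite /V; case: (j == i).
    exact: (measurableT_comp (mZ j) measurable_snd).
  exact: (measurableT_comp (mZ j) measurable_fst).
rewrite (@eq_law_integral _ _ _ _ _ _ _ _ P (P \x P) Z V)//.
- by rewrite (fubini_tonelli1 (fun ww => f (V ^~ ww)))//; exact: measurable_fun_coords.
- by rewrite [X in X < _](iid_law_setT H) ltry.
- move=> A mA.
  have -> : [set ww | forall j, A j (V j ww)] =
      [set w | forall j, j != i -> A j (Z j w)] `*` (Z i @^-1` A i).
    apply/seteqP; split => -[w w'] /=.
      move=> h; split => [j ji|]; last by have := h i; rewrite /V eqxx.
      by have := h j; rewrite /V (negbTE ji).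
    by move=> [h h'] j; rewrite /V; case: eqVneq => [->//|]; exact: h.
  rewrite [LHS]H.2//; apply: esym.
  apply: (etrans (product_measure1E _ _ _ _)).
  - exact: (measurable_box_in (fun j => j != i)).
  - by rewrite -[X in measurable X]setTI; exact: mZ.
  rewrite (iid_law_marginal _ H)// (iid_law_subset _ H)//.
  by rewrite [RHS](bigD1 i)//=; exact: muleC.
Qed.

Lemma iid_law_peel n (Z : 'I_n -> O -> T) (i : 'I_n) (c : R)
    (f g : ('I_n -> T) -> \bar R) :
  iid_law P Z mu -> (0 <= c)%R ->
  measurable_fun setT (fun t : n.-tuple T => f (tnth t)) ->
  measurable_fun setT (fun t : n.-tuple T => g (tnth t)) ->
  (forall t, 0 <= f t) -> (forall t, 0 <= g t) ->
  (forall t, \int[P]_w f (fun j => if j == i then Z j w else t j) <=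
    c%:E * \int[P]_w g (fun j => if j == i then Z j w else t j)) ->
  \int[P]_w f (Z ^~ w) <= c%:E * \int[P]_w g (Z ^~ w).
Proof.
move=> H c0 mf mg f0 g0 fg; have [mZ _] := H.
rewrite (iid_law_decouple i H mf f0) (iid_law_decouple i H mg g0).
pose V (j : 'I_n) (ww : O * O) := if j == i then Z j ww.2 else Z j ww.1.
have mV j : measurable_fun setT (V j).
  rewrite /V; case: (j == i).
    exact: (measurableT_comp (mZ j) measurable_snd).
  exact: (measurableT_comp (mZ j) measurable_fst).
have mint (h : ('I_n -> T) -> \bar R) :
    measurable_fun setT (fun t : n.-tuple T => h (tnth t)) ->
    (forall t, 0 <= h t) ->
    measurable_fun setT
      (fun w => \int[P]_w' h (fun j => if j == i then Z j w' else Z j w)).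
  move=> mh h0.
  apply: (measurable_fun_fubini_tonelli_F (fun ww => h (V ^~ ww))) => //.
  exact: measurable_fun_coords.
rewrite -ge0_integralZl//; last 2 first.
- exact: mint.
- by move=> w _; exact: integral_ge0.
apply: ge0_le_integral => //.
- by move=> w _; exact: integral_ge0.
- exact: mint.
- by apply: measurable_funeM; exact: mint.
Qed.

End iid_law.

(** * Sums of sub-Gaussian noise *)

(** The sum is the expected number of events that occur, so a union bound weighted by these
    probabilities costs [N] and not [#|I|]. *)
Lemma sum_measure_le d (O : measurableType d) (R : realType)
    (P : {measure set O -> \bar R}) (I : finType) (E : I -> set O) (N : nat) :
  (forall i, measurable (E i)) ->
  (forall w, (#|[set i | `[< E i w >] ]%SET| <= N)%N) ->
  (\sum_i P (E i) <= N%:R%:E * P setT)%E.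
Proof.
move=> mE HN.
have -> : (\sum_i P (E i) = \int[P]_w \sum_i (\1_(E i) w)%:E)%E.
  rewrite ge0_integral_sum//=.
  - by apply: eq_bigr => i _; rewrite integral_indic// setIT.
  - by move=> i; exact/measurable_EFinP/measurable_indic.
rewrite -(@integral_cst _ _ _ P setT measurableT N%:R%:E).
apply: ge0_le_integral => //.
- by move=> w _; apply: sume_ge0 => i _; rewrite lee_fin.
- by apply: emeasurable_sum => i; exact/measurable_EFinP/measurable_indic.
- move=> w _; rewrite sumEFin lee_fin/=.
  rewrite (_ : \sum_i _ = #|[set i | `[< E i w >] ]%SET|%:R) ?ler_nat//.
  rewrite -sum1_card natr_sum [RHS]big_mkcond/=; apply: eq_bigr => i _.
  rewrite indicE finset.inE; case: asboolP => h; first by rewrite mem_set.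
  by rewrite memNset.
Qed.

Section subgaussian_sums.
Context d dT dX (O : measurableType d) (T : measurableType dT)
  (TX : measurableType dX) (R : realType).
Variables (P : probability O R) (mu : probability T R) (n : nat).
Variables (Z : 'I_n -> O -> T) (X : T -> TX).
Hypothesis Zlaw : iid_law P Z mu.
Hypothesis mX : measurable_fun setT X.
Variables (G : set ('I_n -> TX)).
Hypothesis mG : measurable [set t : n.-tuple TX | G (tnth t)].

Let mXt (t : 'I_n -> T) (i : 'I_n) :
  measurable [set a | G (fun j => if j == i then a else X (t j))].
Proof.
apply: (measurable_set_coords (V := fun j a => if j == i then a else X (t j))) => // j.
by case: (j == i); [exact: measurable_id|exact: measurable_cst].
Qed.

Let mXZ i : measurable_fun setT (X \o Z i).
Proof. by apply: measurableT_comp => //; have [+ _] := Zlaw. Qed.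

Let mGZ : measurable [set w | G (fun i => X (Z i w))].
Proof. exact: (measurable_set_coords mXZ). Qed.

(** Induction on [J], peeling off one observation at a time. Carrying the indicator of the design
    event [G] through the induction takes the place of conditioning on the design. *)
Lemma subgaussian_sum_mgf (e : T -> R) (s c : R) (J : {set 'I_n}) :
  0 <= c -> measurable_fun setT e ->
  (forall i (A : set TX), measurable A ->
    (\int[P]_w (\1_A (X (Z i w)) * expR (s * e (Z i w)))%:E <=
     c%:E * P [set w | A (X (Z i w))])%E) ->
  (\int[P]_w (\1_G (fun i => X (Z i w)) *
              expR (s * \sum_(i in J) e (Z i w)))%:E <=
   (c ^+ #|J|)%:E * P [set w | G (fun i => X (Z i w))])%E.
Proof.
move=> c0 me He; have [mZ _] := Zlaw.
pose f (K : {set 'I_n}) (z : 'I_n -> T) : \bar R :=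
  (\1_G (X \o z) * expR (s * \sum_(i in K) e (z i)))%:E.
have f0 K z : (0 <= f K z)%E by rewrite lee_fin mulr_ge0// expR_ge0.
have mf K : measurable_fun setT (fun t : n.-tuple T => f K (tnth t)).
  apply/measurable_EFinP; apply: measurable_funM.
    rewrite (_ : (fun t => _) = \1_[set t : n.-tuple T | G (fun i => X (tnth t i))]).
      apply: measurable_indic.
      apply: (measurable_set_coords (V := fun i (t : n.-tuple T) => X (tnth t i))) => // i.
      by apply: measurableT_comp => //; exact: measurable_tnth.
    by apply/funext => t; rewrite !indicE.
  apply: measurableT_comp => //; apply: measurable_funM => //.
  under eq_fun do rewrite big_mkcond/=.
  apply: measurable_sum => i; case: (i \in K) => //.
  by apply: (measurableT_comp me); exact: measurable_tnth.
rewrite -/(f J _).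
have [m] := ubnP #|J|; elim: m J => // m IH J Jm.
have [->|/set0Pn[i iJ]] := eqVneq J finset.set0.
  under eq_integral do rewrite big_set0 mulr0 expR0 mulr1.
  rewrite cards0 expr0 mul1e.
  rewrite (_ : (fun w => _) =
    EFin \o \1_[set w | G (fun i => X (Z i w))]); last first.
    by apply/funext => w; rewrite /= !indicE.
  by rewrite integral_indic//= ?setIT.
pose K := (J :\ i)%SET.
have JK : #|J| = #|K|.+1 by rewrite (cardsD1 i) iJ.
have {}IH := IH K; rewrite -ltnS -JK in IH; have {}IH := IH Jm.
rewrite -/(f K _) in IH.
apply: (@le_trans _ _ (c%:E * \int[P]_w f K (Z ^~ w))%E); last first.
  by rewrite JK exprS EFinM -muleA lee_wpmul2l.
apply: (iid_law_peel (i := i) (f := f J) (g := f K) Zlaw c0) => // t.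
(* With the other observations frozen, [G] is an event [A] about the i-th design point alone and the
   remaining noises form a constant [k], so the hypothesis on one observation applies. *)
pose A := [set a | G (fun j => if j == i then a else X (t j))].
pose k := expR (s * \sum_(j in K) e (t j)).
have GA w : \1_G (X \o (fun j => if j == i then Z j w else t j)) = \1_A (X (Z i w)) :> R.
  rewrite !indicE (_ : X \o _ = fun j => if j == i then X (Z i w) else X (t j)).
    by congr (nat_of_bool _)%:R; apply/idP/idP; rewrite !inE.
  by apply/funext => j /=; case: eqVneq => [->|].
have sumK w : \sum_(j in K) e (if j == i then Z j w else t j) = \sum_(j in K) e (t j).
  by apply: eq_bigr => j; rewrite !finset.inE => /andP[/negbTE -> _].
have fKE w : f K (fun j => if j == i then Z j w else t j) =
    (k%:E * (\1_[set w | A (X (Z i w))] w)%:E)%E.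
  by rewrite /f GA sumK -EFinM mulrC !indicE.
have fJE w : f J (fun j => if j == i then Z j w else t j) =
    (k%:E * (\1_A (X (Z i w)) * expR (s * e (Z i w)))%:E)%E.
  rewrite /f GA (big_setD1 i)//= sumK eqxx -EFinM mulrDr expRD.
  by congr EFin; rewrite -/k; ring.
under eq_integral do rewrite fJE.
under [in leRHS]eq_integral do rewrite fKE.
have k0 : 0 <= k by exact: expR_ge0.
have mA : measurable A := mXt t i.
have mAZ : measurable [set w | A (X (Z i w))].
  by rewrite -[X in measurable X]setTI; exact: mXZ.
rewrite ge0_integralZl//; last first.
  apply/measurable_EFinP; apply: measurable_funM.
    rewrite (_ : (fun w => _) = \1_[set w | A (X (Z i w))]).
      exact: measurable_indic.
    by apply/funext => w; rewrite !indicE.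
  apply: measurableT_comp => //; apply: measurable_funM => //.
  exact: measurableT_comp.
rewrite ge0_integralZl//; last exact/measurable_EFinP/measurable_indic.
rewrite integral_indic// setIT muleCA lee_wpmul2l//.
exact: He.
Qed.

(** The conditional bound on the moment generating function, integrated over the events of the
    design point. *)
Definition subgaussian_given (e : T -> R) (sigma : R) : Prop :=
  measurable_fun setT e /\
  forall (i : 'I_n) (s : R) (A : set TX), measurable A ->
    (\int[P]_w (\1_A (X (Z i w)) * expR (s * e (Z i w)))%:E <=
     (expR (s ^+ 2 * sigma ^+ 2 / 2))%:E * P [set w | A (X (Z i w))])%E.

Lemma measurable_noise_sum (e : T -> R) (J : {set 'I_n}) :
  measurable_fun setT e ->
  measurable_fun setT (fun w => \sum_(i in J) e (Z i w)).
Proof.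
move=> me; under eq_fun do rewrite big_mkcond/=.
apply: measurable_sum => i; case: (i \in J) => //.
by apply: (measurableT_comp me); have [+ _] := Zlaw.
Qed.

(** Exponential Markov inequality on [G]: the threshold contributes exp(-2 Lam), and the moment
    generating function gives back at most exp(Lam). *)
Lemma chernoff_ge (e : T -> R) (sigma Lam v : R) (J : {set 'I_n}) :
  subgaussian_given e sigma -> 0 <= Lam -> 0 < v ->
  2 * sigma ^+ 2 * Lam * #|J|%:R <= v ^+ 2 ->
  (P [set w | G (fun i => X (Z i w)) /\ (v <= \sum_(i in J) e (Z i w))%R] <=
   (expR (- Lam))%:E * P [set w | G (fun i => X (Z i w))])%E.
Proof.
move=> [me He] L0 v0 vJ.
(* Unlike the optimal v / (#|J| sigma^2), this s makes sense for sigma = 0. *)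
pose s := 2 * Lam / v.
have s0 : 0 <= s by rewrite divr_ge0 ?mulr_ge0// ltW.
have mS := measurable_noise_sum J me.
pose F (w : O) : R := \1_G (fun i => X (Z i w)) * expR (s * \sum_(i in J) e (Z i w)).
have F0 w : 0 <= F w by rewrite mulr_ge0// expR_ge0.
have mF : measurable_fun setT (EFin \o F).
  apply/measurable_EFinP; apply: measurable_funM.
    rewrite (_ : (fun w => _) = \1_[set w | G (fun i => X (Z i w))]).
      exact: measurable_indic.
    by apply/funext => w; rewrite !indicE.
  by apply: measurableT_comp => //; exact: measurable_funM.
set E := [set w | _ /\ _].
have mE : measurable E.
  apply: measurableI => //.
  by have := measurable_fun_ler (measurable_cst v) mS measurableT;
    move=> /(_ [set true] I); rewrite setTI preimage_true.
rewrite -[P E]/(P E) -(setIT E) -(integral_indic _ measurableT)//.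
apply: (@le_trans _ _ (\int[P]_w ((expR (- (s * v)))%:E * (F w)%:E))%E).
  apply: ge0_le_integral => //.
  - exact/measurable_EFinP/measurable_indic.
  - exact: measurable_funeM.
  - move=> w _; rewrite -EFinM lee_fin; have [[Gw vw]|nE] := pselect (E w).
      rewrite indicE mem_set// /F indicE mem_set// mul1r -expRD.
      rewrite -[leLHS]expR0 ler_expR addrC subr_ge0 ler_wpM2l//.
    by rewrite indicE memNset// mulr_ge0// expR_ge0.
rewrite ge0_integralZl//; last first.
  by move=> w _; rewrite lee_fin.
apply: le_trans.
  apply: lee_wpmul2l; first by rewrite lee_fin expR_ge0.
  by apply: (@subgaussian_sum_mgf e s _ J _ me (He ^~ s)); exact: expR_ge0.
rewrite muleA -EFinM lee_wpmul2r//.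
rewrite lee_fin -expRM_natl -expRD ler_expR.
have -> : s * v = 2 * Lam by rewrite /s mulfVK// gt_eqF.
have : #|J|%:R * (s ^+ 2 * sigma ^+ 2 / 2) <= Lam; last by lra.
rewrite (_ : _ * _ = Lam * ((2 * sigma ^+ 2 * Lam * #|J|%:R) / v ^+ 2)).
  rewrite -[leRHS]mulr1 ler_wpM2l// ler_pdivrMr ?mul1r// exprn_gt0//.
by rewrite /s; field; rewrite gt_eqF.
Qed.

(** The threshold [u] may vanish, whereas [chernoff_ge] wants a positive one: the strict event is
    the increasing union of those at thresholds u + 1/(m+1). *)
Lemma chernoff_gt (e : T -> R) (sigma Lam : R) (J : {set 'I_n}) :
  subgaussian_given e sigma -> 0 <= Lam ->
  (P [set w | G (fun i => X (Z i w)) /\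
     (Num.sqrt (2 * sigma ^+ 2 * Lam * #|J|%:R) < \sum_(i in J) e (Z i w))%R] <=
   (expR (- Lam))%:E * P [set w | G (fun i => X (Z i w))])%E.
Proof.
move=> He L0; have me := He.1; set u := Num.sqrt _.
have u0 : 0 <= u by exact: sqrtr_ge0.
have mS := measurable_noise_sum J me.
pose F (m : nat) := [set w | G (fun i => X (Z i w)) /\
  u + m.+1%:R^-1 <= \sum_(i in J) e (Z i w)].
have mF m : measurable (F m).
  apply: measurableI => //.
  have := measurable_fun_ler (measurable_cst (u + m.+1%:R^-1)) mS measurableT.
  by move=> /(_ [set true] I); rewrite setTI preimage_true.
have -> : [set w | G (fun i => X (Z i w)) /\ u < \sum_(i in J) e (Z i w)] =
    \bigcup_m F m.
  apply/seteqP; split => w /=.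
    move=> [Gw]; rewrite -subr_gt0 => /ltr_add_invr [m].
    by rewrite add0r => h; exists m => //; split => //=; rewrite -lerBrDl ltW.
  move=> [m _ [Gw h]]; split => //; apply: lt_le_trans h.
  by rewrite ltrDl invr_gt0.
have ndF : nondecreasing_seq F.
  move=> m1 m2 m12; apply/subsetPset => w [Gw h]; split => //.
  apply: le_trans h; rewrite lerD2l lef_pV2 ?posrE// ler_nat ltnS//.
have mUF : measurable (\bigcup_m F m) by exact: bigcupT_measurable.
have cv := nondecreasing_cvg_mu mF mUF ndF (mu := P).
rewrite -(cvg_lim _ cv)//; apply: lime_le.
  by apply/cvg_ex; eexists; exact: cv.
apply: nearW => m; apply: (chernoff_ge He) => //.
  by rewrite ltr_wpDl// invr_gt0.
rewrite -[leLHS]sqr_sqrtr; last first.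
  by do 3! apply: mulr_ge0 => //; exact: sqr_ge0.
by rewrite ler_pXn2r ?nnegrE ?addr_ge0// lerDl.
Qed.

Lemma chernoff_abs (e : T -> R) (sigma Lam : R) (J : {set 'I_n}) :
  subgaussian_given e sigma -> 0 <= Lam ->
  (P [set w | G (fun i => X (Z i w)) /\
     (Num.sqrt (2 * sigma ^+ 2 * Lam * #|J|%:R) < `|\sum_(i in J) e (Z i w)|)%R] <=
   (2 * expR (- Lam))%:E * P [set w | G (fun i => X (Z i w))])%E.
Proof.
move=> He L0; have [me He'] := He.
have meN : measurable_fun setT (fun t => - e t) by exact: measurableT_comp.
have HeN : subgaussian_given (fun t => - e t) sigma.
  split=> // i s A mA; under eq_integral do rewrite mulrN -mulNr.
  by have := He' i (- s) A mA; rewrite sqrrN.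
have mS := measurable_noise_sum J me.
have mSN := measurable_noise_sum J meN.
set u := Num.sqrt _.
rewrite (_ : [set w | _] =
  [set w | G (fun i => X (Z i w)) /\ (u < \sum_(i in J) e (Z i w))%R] `|`
  [set w | G (fun i => X (Z i w)) /\ (u < \sum_(i in J) - e (Z i w))%R]).
  apply: le_trans.
    apply: measureU2; apply: measurableI => //; exact: measurable_set_ltr.
  apply: (le_trans (leeD (chernoff_gt J He L0) (chernoff_gt J HeN L0))).
  by rewrite -ge0_muleDl ?lee_fin ?expR_ge0// -EFinD mulrDl mul1r.
apply/seteqP; split => w /=; rewrite sumrN ltr_normr.
  by move=> [Gw /orP[]]; [left|right].
by move=> [] [Gw ->]; rewrite ?orbT.
Qed.

End subgaussian_sums.

(** * Noise bound uniform over ball traces *)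

Lemma measure_fin_bigcup_le d (O : measurableType d) (R : realType)
    (P : {measure set O -> \bar R}) (I : Type) (s : seq I) (E : I -> set O) :
  (forall i, measurable (E i)) ->
  measurable (\big[setU/set0]_(i <- s) E i) /\
  (P (\big[setU/set0]_(i <- s) E i) <= \sum_(i <- s) P (E i))%E.
Proof.
move=> mE; elim: s => [|i s [IH1 IH2]].
  by rewrite !big_nil measure0; split.
rewrite !big_cons; split; first exact: measurableU.
by apply: (le_trans (measureU2 _ _ _)) => //; rewrite leeD2l.
Qed.

Lemma measurable_ball_trace_tuple (R : realType) (d n : nat) (J : {set 'I_n}) :
  measurable [set t : n.-tuple (d.-tuple R) | ball_trace J (tnth t)].
Proof.
apply: (measurable_ball_trace J (xs := fun i (t : n.-tuple (d.-tuple R)) => tnth t i)) => i.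
exact: measurable_tnth.
Qed.

Section noise.
Context dO dT (O : measurableType dO) (T : measurableType dT) (R : realType).
Variables (d n : nat) (P : probability O R) (mu : probability T R).
Variables (Z : 'I_n -> O -> T) (X : T -> d.-tuple R) (e : T -> R).
Variables (sigma Lam delta : R).
Hypothesis Zlaw : iid_law P Z mu.
Hypothesis mX : measurable_fun setT X.

(** Each [J] costs 2 exp(-Lam) times the probability that it is a trace; the two tails account for
    [2 * delta]. *)
Lemma noise_bound_ball_traces :
  subgaussian_given P Z X e sigma -> 0 <= Lam ->
  (n + 1)%:R ^+ d.+1 * expR (- Lam) <= delta ->
  exists2 B : set O, measurable B /\ (P B <= (2 * delta)%:E)%E &
    forall w, ~ B w -> forall J, ball_trace J (fun i => X (Z i w)) ->
    `|\sum_(i in J) e (Z i w)| <= Num.sqrt (2 * sigma ^+ 2 * Lam * #|J|%:R).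
Proof.
move=> He L0 Hdelta.
pose B (J : {set 'I_n}) := [set w | ball_trace J (fun i => X (Z i w)) /\
  Num.sqrt (2 * sigma ^+ 2 * Lam * #|J|%:R) < `|\sum_(i in J) e (Z i w)|].
have mXZ i : measurable_fun setT (X \o Z i).
  by apply: measurableT_comp => //; have [+ _] := Zlaw.
have mtr J : measurable [set w | ball_trace J (fun i => X (Z i w))].
  exact: (measurable_ball_trace J (xs := fun i w => X (Z i w))).
have mB J : measurable (B J).
  rewrite /B; apply: measurableI; first exact: mtr.
  apply: measurable_set_ltr => //.
  by apply: measurableT_comp => //; apply: (measurable_noise_sum Zlaw); exact: He.1.
have [mU PU] := measure_fin_bigcup_le P (index_enum _) mB.
exists (\big[setU/set0]_J B J); last first.
  move=> w nB J Jw; rewrite leNgt; apply/negP => h; apply: nB.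
  by rewrite -bigcup_seq; exists J; rewrite //= mem_index_enum.
split => //; apply: (le_trans PU).
apply: (@le_trans _ _ (\sum_J (2 * expR (- Lam))%:E *
    P [set w | ball_trace J (fun i => X (Z i w))])%E).
  apply: lee_sum => J _.
  exact: (chernoff_abs Zlaw mX (@measurable_ball_trace_tuple R d n J)).
rewrite -ge0_sume_distrr//.
apply: (@le_trans _ _ ((2 * expR (- Lam))%:E * ((n.+1 ^ d.+1)%:R%:E * P setT))%E).
  rewrite lee_wpmul2l ?lee_fin ?mulr_ge0 ?expR_ge0//.
  apply: sum_measure_le => // w.
  by rewrite -[X in (_ <= X.+1 ^ _)%N]card_ord; exact: card_ball_trace.
rewrite probability_setT mule1 -EFinM lee_fin natrX -(addn1 n).
by rewrite -mulrA ler_wpM2l// mulrC.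
Qed.

End noise.

(** * Exchanging the sample and the ghost sample *)

Section swap.
Variable n : nat.
Implicit Types (s : {ffun 'I_n -> bool}) (J : {set 'I_(n + n)}).

Definition swap_fun s (j : 'I_(n + n)) : 'I_(n + n) :=
  match fintype.split j with
  | inl i => if s i then rshift n i else lshift n i
  | inr i => if s i then lshift n i else rshift n i
  end.

Lemma split_lshift (i : 'I_n) : fintype.split (lshift n i) = inl i.
Proof. by rewrite -[lshift n i]/(unsplit (inl i)) unsplitK. Qed.

Lemma split_rshift (i : 'I_n) : fintype.split (rshift n i) = inr i.
Proof. by rewrite -[rshift n i]/(unsplit (inr i)) unsplitK. Qed.

Lemma swap_funK s : involutive (swap_fun s).
Proof.
move=> j; rewrite -(splitK j); case: (fintype.split j) => i;
  rewrite /swap_fun /= ?(split_lshift, split_rshift).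
  by case: ifP => si; rewrite ?(split_lshift, split_rshift) si.
by case: ifP => si; rewrite ?(split_lshift, split_rshift) si.
Qed.

Definition swap s : {perm 'I_(n + n)} := perm (can_inj (swap_funK s)).

Lemma swapK s : involutive (swap s).
Proof. by move=> j; rewrite !permE swap_funK. Qed.

Variable R : realType.

(* The weights 2/3 and 4/3 have mean 1 and product 8/9 <= 1, so a set of indices
   has weight at most 1 on average over all the swaps of the two samples. *)
Definition ghost_weight J : R :=
  \prod_(i < n) ((if lshift n i \in J then 2 / 3 else 1) *
                 (if rshift n i \in J then 4 / 3 else 1)).

Lemma ghost_weight_ge0 J : 0 <= ghost_weight J.
Proof. by apply: prodr_ge0 => i _; case: ifP => _; case: ifP => _; lra. Qed.

(** The sum over swaps factors over the pairs. A pair meeting [J] in one index gives 2/3 + 4/3 = 2,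
    in two indices 8/9 + 8/9, in none 1 + 1. *)
Lemma sum_ghost_weight_le J :
  \sum_(s : {ffun 'I_n -> bool}) ghost_weight (swap s @^-1: J) <= 2 ^+ n.
Proof.
pose a (i : 'I_n) (b : bool) : R :=
  (if (if b then rshift n i else lshift n i) \in J then 2 / 3 else 1) *
  (if (if b then lshift n i else rshift n i) \in J then 4 / 3 else 1).
have -> : \sum_(s : {ffun 'I_n -> bool}) ghost_weight (swap s @^-1: J) =
    \sum_(s : {ffun 'I_n -> bool}) \prod_i a i (s i).
  apply: eq_bigr => s _; apply: eq_bigr => i _; rewrite !finset.inE !permE.
  by rewrite /swap_fun split_lshift split_rshift.
rewrite -bigA_distr_bigA -[n in 2 ^+ n]card_ord -prodr_const.
apply: ler_prod => i _; rewrite big_bool /a/=; apply/andP.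
by case: (_ \in J); case: (_ \in J); split; lra.
Qed.

End swap.

Lemma ball_trace_perm (R : realType) (d : nat) (I : finType) (J : {set I})
    (s : {perm I}) (xs : I -> d.-tuple R) :
  ball_trace (s @^-1: J) (xs \o s) <-> ball_trace J xs.
Proof.
split=> -[q cut]; exists q => i; last by have := cut (s i); rewrite finset.inE.
by have := cut ((s^-1)%g i); rewrite finset.inE /comp permKV.
Qed.

(** * Balls containing few sample points *)

(** [iid_law] speaks of boxes, so the product is expanded over sets [J] of indices into indicators
    of the boxes [E J], and the result is folded back by the same expansion. *)
Lemma integral_prod_iid dO dT (O : measurableType dO) (T : measurableType dT)
    (R : realType) (n : nat) (P : probability O R) (mu : probability T R)
    (Z : 'I_n -> O -> T) (A : set T) (a : R) :
  iid_law P Z mu -> measurable A -> 0 <= a ->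
  (\int[P]_w (\prod_(i < n) (a * \1_A (Z i w) + 1))%:E =
   ((a * fine (mu A) + 1) ^+ n)%:E)%E.
Proof.
move=> Zlaw mA a0; have [mZ _] := Zlaw; set p := fine (mu A).
pose E (J : {set 'I_n}) := [set w | forall i, i \in J -> A (Z i w)].
have mE J : measurable (E J) by exact: (measurable_box_in (fun i => i \in J) mZ (fun=> mA)).
have prodJ (J : {set 'I_n}) (x : R) :
    \prod_(i < n) (if i \in J then x else 1) = x ^+ #|J|.
  by rewrite -big_mkcond/= prodr_const.
have PE J : P (E J) = (p ^+ #|J|)%:E.
  rewrite (iid_law_subset (fun i => i \in J) Zlaw (fun=> mA)).
  by rewrite -[mu A]fineK ?fin_num_measure// prodEFin prodr_const.
have expand w : (\prod_(i < n) (a * \1_A (Z i w) + 1))%:E =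
    (\sum_(J : {set 'I_n}) (a ^+ #|J|)%:E * (\1_(E J) w)%:E)%E.
  rewrite bigA_distr/= -sumEFin; apply: eq_bigr => J _; rewrite -EFinM -prodJ.
  congr EFin; rewrite indicE; have [EJ|nEJ] := pselect (E J w).
    rewrite mem_set// mulr1; apply: eq_bigr => i _; case: ifP => // iJ.
    by rewrite indicE mem_set ?mulr1//; exact: EJ.
  rewrite memNset// mulr0; have [i iJ nA] : exists2 i, i \in J & ~ A (Z i w).
    by apply: contrapT => h; apply: nEJ => i iJ; apply: contrapT => nA; apply: h; exists i.
  by rewrite (bigD1 i)//= iJ indicE memNset// mulr0 mul0r.
under eq_integral do rewrite expand.
rewrite ge0_integral_sum//; last 2 first.
- by move=> J; apply: measurable_funeM; exact/measurable_EFinP/measurable_indic.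
- by move=> J w _; rewrite -EFinM lee_fin mulr_ge0// exprn_ge0.
rewrite (_ : (a * p + 1) ^+ n = \prod_(i < n) (a * p + 1)); last first.
  by rewrite prodr_const card_ord.
rewrite bigA_distr/= -sumEFin; apply: eq_bigr => J _.
rewrite ge0_integralZl//; last 2 first.
- exact/measurable_EFinP/measurable_indic.
- by rewrite lee_fin exprn_ge0.
rewrite prodJ exprMn EFinM; congr (_ * _)%E.
by rewrite integral_indic// setIT; exact: PE.
Qed.

(** Convexity of exp: the tangent at p a lies below the graph at 0 and at a ([h0], [h1]); average
    with weights 1 - p and p. *)
Lemma expR_chord (R : realType) (a p : R) : 0 <= p <= 1 ->
  expR (p * a) <= 1 - p + p * expR a.
Proof.
move=> /andP[p0 p1].
have h0 : expR (p * a) * (1 - p * a) <= 1.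
  by rewrite -[leRHS](expRxMexpNx_1 (p * a)) ler_wpM2l ?expR_ge0// expR_ge1Dx.
have h1 : expR (p * a) * (1 + (1 - p) * a) <= expR a.
  rewrite [in leRHS](_ : a = p * a + (1 - p) * a); last by ring.
  by rewrite expRD ler_wpM2l ?expR_ge0// expR_ge1Dx.
have q0 : 0 <= 1 - p by rewrite subr_ge0.
have := lerD (ler_wpM2l q0 h0) (ler_wpM2l p0 h1).
by rewrite mulr1; apply: le_trans; rewrite le_eqVlt; apply/orP; left; apply/eqP; ring.
Qed.

(** Jensen's inequality for a binomial variable B of parameters n and p: the right-hand side is the
    mean of (4/3)^B. *)
Lemma four_thirds_power (R : realType) (p : R) (n m : nat) :
  0 <= p <= 1 -> m%:R <= n%:R * p ->
  (4 / 3) ^+ m <= (1 / 3 * p + 1) ^+ n.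
Proof.
move=> p01 mnp; have h : 0 < 4 / 3 :> R by lra.
have l0 : 0 <= ln (4 / 3) :> R by rewrite ln_ge0//; lra.
rewrite -[4 / 3]lnK ?posrE// -expRM_natl.
apply: (@le_trans _ _ (expR (p * ln (4 / 3)) ^+ n)).
  by rewrite -expRM_natl ler_expR mulrA ler_wpM2r.
apply: lerXn2r; rewrite ?nnegrE ?expR_ge0//.
  by have /andP[? ?] := p01; lra.
apply: (le_trans (expR_chord _ p01)); rewrite lnK ?posrE//.
by lra.
Qed.

Lemma measurable_eucl_cball (R : realType) (d : nat) (c : d.-tuple R) (r : R) :
  measurable (eucl_cball c r).
Proof.
have mdist : measurable_fun setT (eucl_dist c).
  apply: measurableT_comp => //.
    by apply: continuous_measurable_fun; exact: sqrt_continuous.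
  apply: measurable_sum => j; apply: measurable_funX.
  by apply: measurable_funB => //; exact: measurable_tnth.
have := measurable_fun_ler mdist (measurable_cst r) measurableT.
by move=> /(_ [set true] I); rewrite setTI preimage_true.
Qed.

Lemma count_inE (R : realType) (d n : nat) (xs : 'I_n -> d.-tuple R) c r :
  count_in xs (eucl_cball c r) = #|[set i | eucl_dist c (xs i) <= r]%SET|%:R.
Proof.
rewrite /count_in -sum1_card natr_sum [RHS]big_mkcond/=.
apply: eq_bigr => i _; rewrite indicE finset.inE.
rewrite (_ : (xs i \in eucl_cball c r) = (eucl_dist c (xs i) <= r)).
  by case: (_ <= _).
by apply/idP/idP; rewrite inE.
Qed.

Section radius.
Context dO (O : measurableType dO) (R : realType).
Variables (d n : nat) (P : probability O R).
Variables (mu : probability (d.-tuple R) R) (Xs : 'I_n -> O -> d.-tuple R).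
Hypothesis Xlaw : iid_law P Xs mu.

Let mX : forall i, measurable_fun setT (Xs i) := Xlaw.1.

Definition ghost_sum (z : 'I_(n + n) -> d.-tuple R) : R :=
  \sum_(J : {set 'I_(n + n)}) \1_(ball_trace J) z * ghost_weight R J.

Lemma ghost_sum_ge0 z : 0 <= ghost_sum z.
Proof. by apply: sumr_ge0 => J _; rewrite mulr_ge0// ghost_weight_ge0. Qed.

Let mtrace (J : {set 'I_(n + n)}) :
  measurable_fun setT (fun t : (n + n).-tuple (d.-tuple R) =>
    \1_(ball_trace J) (tnth t) : R).
Proof.
rewrite (_ : (fun t => _) = \1_[set t : (n + n).-tuple _ | ball_trace J (tnth t)]).
  by apply: measurable_indic; exact: measurable_ball_trace_tuple.
by apply/funext => t; rewrite !indicE.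
Qed.

Lemma measurable_ghost_sum :
  measurable_fun setT (fun t : (n + n).-tuple (d.-tuple R) =>
    (ghost_sum (tnth t))%:E).
Proof.
apply/measurable_EFinP; apply: measurable_sum => J.
exact: measurable_funM.
Qed.

(** Traces follow the points, so swapping the points only changes the weights. *)
Lemma ghost_sum_swap (s : {ffun 'I_n -> bool}) (z : 'I_(n + n) -> d.-tuple R) :
  ghost_sum (z \o swap s) = \sum_(J : {set 'I_(n + n)})
    \1_(ball_trace J) z * ghost_weight R (swap s @^-1: J).
Proof.
have sK : involutive (fun J : {set 'I_(n + n)} => swap s @^-1: J)%SET.
  by move=> J; apply/setP => j; rewrite !finset.inE swapK.
rewrite /ghost_sum (reindex_inj (inv_inj sK))/=; apply: eq_bigr => J _.
congr (_ * _); rewrite !indicE; congr (nat_of_bool _)%:R.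
by apply/idP/idP; rewrite !inE => /ball_trace_perm.
Qed.

Lemma integral_ghost_sum_le :
  (\int[P \x P]_ww (ghost_sum ((ghost Xs) ^~ ww))%:E <=
   ((n + n).+1 ^ d.+1)%:R%:E)%E.
Proof.
have Glaw := iid_law_ghost Xlaw.
(* [N] is the number of swaps. Multiplying by it makes a sum over swaps, each of which leaves the
   integral unchanged. *)
pose N := (2 ^+ n : R)%:E.
have N0 : (0 < N)%E by rewrite lte_fin exprn_gt0.
rewrite -(@lee_pmul2l _ N)//.
have NE : N = (\sum_(s : {ffun 'I_n -> bool}) 1%:E)%E.
  rewrite sumEFin sumr_const card_ffun card_bool card_ord.
  by rewrite /N -natrX.
rewrite [X in (X * \int[_]__ _)%E]NE ge0_sume_distrl//.
have swapE (s : {ffun 'I_n -> bool}) :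
    (\int[P \x P]_ww (ghost_sum (ghost Xs ^~ ww))%:E =
     \int[P \x P]_ww (ghost_sum (fun i => ghost Xs (swap s i) ww))%:E)%E.
  apply: (iid_law_integral_perm (f := EFin \o ghost_sum) (swap s) Glaw).
    exact: measurable_ghost_sum.
  by move=> z; rewrite lee_fin ghost_sum_ge0.
under eq_bigr => s _ do rewrite mul1e (swapE s).
have mg (s : {ffun 'I_n -> bool}) : measurable_fun setT
    (fun ww => (ghost_sum (fun i => ghost Xs (swap s i) ww))%:E).
  apply: (measurable_fun_coords (f := EFin \o ghost_sum)).
    by move=> i; exact: Glaw.1.
  exact: measurable_ghost_sum.
rewrite -ge0_integral_sum//=; last first.
  by move=> s ww _; rewrite lee_fin ghost_sum_ge0.
have mtr (J : {set 'I_(n + n)}) : measurable [set ww | ball_trace J (ghost Xs ^~ ww)].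
  by apply: measurable_ball_trace => i; exact: Glaw.1.
(* For a fixed trace the weights sum to at most [N] over the swaps; what remains is the number of
   traces on 2n points. *)
apply: (@le_trans _ _ (\int[P \x P]_ww (N *
    \sum_(J : {set 'I_(n + n)}) (\1_[set ww | ball_trace J (ghost Xs ^~ ww)] ww)%:E))%E).
  apply: ge0_le_integral => //.
  - by move=> ww _; apply: sume_ge0 => s _; rewrite lee_fin ghost_sum_ge0.
  - exact: emeasurable_sum.
  - apply: measurable_funeM; apply: emeasurable_sum => J.
    exact/measurable_EFinP/measurable_indic.
  - move=> ww _; rewrite !sumEFin lee_fin.
    under eq_bigr do rewrite (ghost_sum_swap _ (ghost Xs ^~ ww)).
    rewrite exchange_big mulr_sumr/=; apply: ler_sum => J _.
    have -> : \1_[set ww | ball_trace J (ghost Xs ^~ ww)] ww =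
        \1_(ball_trace J) (ghost Xs ^~ ww) :> R by rewrite !indicE.
    by rewrite -mulr_sumr mulrC ler_wpM2r// sum_ghost_weight_le.
rewrite ge0_integralZl//; last 3 first.
- apply: emeasurable_sum => J.
  exact/measurable_EFinP/measurable_indic.
- by move=> ww _; apply: sume_ge0 => J _; rewrite lee_fin.
- exact: ltW.
rewrite lee_wpmul2l//; first exact: ltW.
rewrite ge0_integral_sum//; last first.
  by move=> J; exact/measurable_EFinP/measurable_indic.
under eq_bigr do rewrite integral_indic// setIT.
apply: (le_trans (sum_measure_le (N := (n + n).+1 ^ d.+1) _ mtr _)).
  move=> ww; rewrite -[X in (_ <= X.+1 ^ _)%N]card_ord; exact: card_ball_trace.
by rewrite [X in (_ * X)%E](iid_law_setT Glaw) mule1.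
Qed.

Lemma undersampled_balls (k : nat) (delta : R) : 0 < delta ->
  (n + n).+1%:R ^+ d.+1 <= delta * (32 / 27) ^+ k ->
  exists2 B : set O, measurable B /\ (P B <= delta%:E)%E &
    forall w, ~ B w -> forall c r, 0 <= r ->
    ((2 * k)%:R%:E <= n%:R%:E * mu (eucl_cball c r))%E ->
    k%:R <= count_in (Xs ^~ w) (eucl_cball c r).
Proof.
move=> d0 Hk; have Glaw := iid_law_ghost Xlaw.
pose K : R := (32 / 27) ^+ k.
have K0 : 0 < K by rewrite exprn_gt0.
(* Only the ghost sample is integrated out, so the exceptional event [K <= G] concerns the actual
   sample; Markov's inequality bounds its probability. *)
pose G w := (\int[P]_w' (ghost_sum (ghost Xs ^~ (w, w')))%:E)%E.
have mgh : measurable_fun setT (fun ww => (ghost_sum (ghost Xs ^~ ww))%:E).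
  apply: (measurable_fun_coords (f := EFin \o ghost_sum)).
    by move=> i; exact: Glaw.1.
  exact: measurable_ghost_sum.
have gh0 ww : (0 <= (ghost_sum (ghost Xs ^~ ww))%:E)%E.
  by rewrite lee_fin ghost_sum_ge0.
have mG : measurable_fun setT G.
  exact: (measurable_fun_fubini_tonelli_F (fun ww => (ghost_sum (ghost Xs ^~ ww))%:E)).
have mB : measurable [set w | (K%:E <= G w)%E].
  by rewrite -[X in measurable X]setTI; exact: measurable_lee.
exists [set w | (K%:E <= G w)%E].
  split => //; rewrite -(@lee_pmul2l _ K%:E) ?lte_fin//.
  rewrite -{1}[[set w | _]]setIT -(integral_indic _ measurableT)//.
  rewrite -ge0_integralZl//; [|exact/measurable_EFinP/measurable_indic|exact: ltW].
  apply: (@le_trans _ _ (\int[P]_w G w)%E).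
    apply: ge0_le_integral => //.
    - by move=> w _; rewrite mule_ge0// lee_fin ltW.
    - by apply: measurable_funeM; exact/measurable_EFinP/measurable_indic.
    - move=> w _; rewrite indicE; case: (boolP (w \in _)) => [|_].
        by rewrite inE /= mule1.
      by rewrite mule0 integral_ge0.
  rewrite -(fubini_tonelli1 (fun ww => (ghost_sum (ghost Xs ^~ ww))%:E))//.
  apply: (le_trans integral_ghost_sum_le).
  by rewrite -EFinM lee_fin natrX mulrC.
move=> w nB c r r0 Hmu; rewrite leNgt; apply/negP => Nk; apply: nB => /=.
set A := eucl_cball c r in Hmu Nk *.
have mA : measurable A by exact: measurable_eucl_cball.
set p := fine (mu A).
have muA : mu A = p%:E by rewrite fineK ?fin_num_measure.
have p01 : 0 <= p <= 1.
  by rewrite -!lee_fin -muA measure_ge0 probability_le1.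
rewrite muA -EFinM lee_fin in Hmu.
pose N := #|[set i | eucl_dist c (Xs i w) <= r]%SET|.
have {}Nk : (N <= k)%N by rewrite -ltnS ltnW// ltnS -(ltr_nat R) -count_inE.
(* Weight of the trace of [A] on both samples: 2/3 for each of the [N] sample points in [A], and 4/3
   = 1/3 + 1 for each ghost point in [A]. *)
have weightE w' : ghost_weight R [set j | eucl_dist c (ghost Xs j (w, w')) <= r]%SET =
    (2 / 3) ^+ N * \prod_(i < n) (1 / 3 * \1_A (Xs i w') + 1).
  rewrite /ghost_weight big_split/=; congr (_ * _).
    rewrite -big_mkcond/= -prodr_const; apply: eq_bigl => i.
    by rewrite !finset.inE /ghost split_lshift.
  apply: eq_bigr => i _; rewrite finset.inE /ghost split_rshift/= indicE.
  rewrite (_ : (Xs i w' \in A) = (eucl_dist c (Xs i w') <= r)).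
    by case: (_ <= _) => /=; rewrite ?mulr1 ?mulr0; lra.
  by apply/idP/idP; rewrite inE.
have mprod : measurable_fun setT
    (fun w' => (\prod_(i < n) (1 / 3 * \1_A (Xs i w') + 1) : R)%:E).
  apply/measurable_EFinP; apply: measurable_prod => i _.
  apply: measurable_funD => //; apply: measurable_funM => //.
  rewrite (_ : (fun w' => _) = \1_(Xs i @^-1` A)).
    by apply: measurable_indic; rewrite -[X in measurable X]setTI; exact: mX.
  by apply/funext => w'; rewrite !indicE.
have prod0 w' : 0 <= \prod_(i < n) (1 / 3 * \1_A (Xs i w') + 1) :> R.
  by apply: prodr_ge0 => i _; rewrite addr_ge0 ?mulr_ge0// divr_ge0.
(* The ghost sum is bounded below by its single term for [A], whose mean is at least (2/3)^k
   (4/3)^(2k) = [K]. *)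
apply: (@le_trans _ _ (\int[P]_w' (((2 / 3) ^+ N)%:E *
    (\prod_(i < n) (1 / 3 * \1_A (Xs i w') + 1))%:E))%E).
  rewrite ge0_integralZl//; last first.
    by move=> w' _; rewrite lee_fin.
  rewrite (integral_prod_iid Xlaw mA) ?divr_ge0// -EFinM lee_fin.
  have := four_thirds_power p01 Hmu.
  have h : (2 / 3) ^+ k <= (2 / 3) ^+ N :> R.
    by rewrite ler_wiXn2l//; lra.
  move=> /(ler_pM _ _ h) ; rewrite ?exprn_ge0 ?divr_ge0// => /(_ isT isT).
  apply: le_trans; rewrite exprM -exprMn /K.
  by rewrite (_ : 2 / 3 * _ = 32 / 27 :> R)//; field.
apply: ge0_le_integral => //.
- by move=> w' _; rewrite -EFinM lee_fin mulr_ge0// exprn_ge0// divr_ge0.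
- exact: measurable_funeM.
- apply: (measurableT_comp mgh); exact: measurable_pair1.
- move=> w' _; rewrite -EFinM lee_fin -weightE /ghost_sum.
  set J := [set j | _]%SET; rewrite (bigD1 J)//= indicE mem_set.
    by rewrite mul1r lerDl sumr_ge0// => J' _; rewrite mulr_ge0// ghost_weight_ge0.
  exact: ball_traceP.
Qed.

End radius.

(** * Error of the nearest-neighbor average *)

Section deterministic.
Variables (R : realType) (d n k : nat).
Variables (S : set (d.-tuple R)) (g : d.-tuple R -> R) (L : R).
Variables (xs : 'I_n -> d.-tuple R) (ys : 'I_n -> R).
Hypothesis gL : eucl_lipschitz_on L S g.

Lemma local_lipschitz_set_neq0 (V : set (d.-tuple R)) :
  [set c : R | 0 <= c /\ eucl_lipschitz_on c (V `&` S) g] !=set0.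
Proof.
(* The admissible constants are nonnegative, while [L] comes with no sign. *)
exists (Num.max L 0); split; first by rewrite le_max lexx orbT.
move=> x y [_ Sx] [_ Sy]; apply: (le_trans (gL Sx Sy)).
by rewrite ler_wpM2r ?eucl_dist_ge0// le_max lexx.
Qed.

Lemma local_lipschitz_const_ge0 (V : set (d.-tuple R)) :
  0 <= local_lipschitz_const S g V.
Proof.
apply: lb_le_inf; first exact: local_lipschitz_set_neq0.
by move=> c [].
Qed.

(** Every admissible constant is at least |g x - g y| / tau, hence so is the infimum. Dividing by
    [tau] and not by the distance covers x = y. *)
Lemma local_lipschitz_const_bound (V : set (d.-tuple R)) (tau : R) x y :
  0 < tau -> V x -> S x -> V y -> S y -> eucl_dist x y <= tau ->
  `|g x - g y| <= tau * local_lipschitz_const S g V.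
Proof.
move=> tau0 Vx Sx Vy Sy xy; rewrite -ler_pdivrMl// mulrC.
apply: lb_le_inf; first exact: local_lipschitz_set_neq0.
move=> c [c0 gc]; rewrite ler_pdivrMr//.
by apply: (le_trans (gc x y _ _)) => //; rewrite ler_wpM2l.
Qed.

Lemma knn_radius_le (x : d.-tuple R) (tau : R) :
  0 < tau -> k%:R <= count_in xs (eucl_cball x tau) ->
  [/\ 0 <= knn_radius k xs x, knn_radius k xs x <= tau &
      k%:R <= count_in xs (eucl_cball x (knn_radius k xs x))].
Proof.
move=> tau0 ktau; set E := [set t : R | 0 < t /\ k%:R <= count_in xs (eucl_cball x t)].
have E0 : E !=set0 by exists tau.
have lbE : lbound E 0 by move=> t [/ltW].
have infE : has_inf E by split => //; exists 0.
split; [exact: lb_le_inf|by apply: ge_inf => //; exists 0|].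
(* A radius above the infimum by less than the gap to the nearest outside point captures no new
   point, so the ball at the infimum already holds [k] of them. *)
have [e e0 He] := fin_lt_pos (fun i => eucl_dist x (xs i) - knn_radius k xs x).
have [t [t0 kt] te] := inf_adherent e0 infE.
apply: (le_trans kt); rewrite !count_inE ler_nat.
apply/subset_leq_card/fintype.subsetP => i; rewrite !finset.inE => it.
rewrite leNgt; apply/negP => ih.
have /He : 0 < eucl_dist x (xs i) - knn_radius k xs x by rewrite subr_gt0.
by move: te; rewrite -/(knn_radius k xs x); lra.
Qed.

(** Noise plus bias. The noise average is at most sqrt(v / #|J|) with [#|J|] at least [k], possibly
    larger because of ties; the bias is controlled by the distance [tau] to the neighbors. *)
Lemma knn_error_bound (x : d.-tuple R) (tau v : R) :
  (0 < k)%N -> 0 <= v -> S x -> (forall i, S (xs i)) -> 0 < tau ->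
  k%:R <= count_in xs (eucl_cball x tau) ->
  (forall r (J := [set i | eucl_dist x (xs i) <= r]%SET), 0 <= r ->
    `|\sum_(i in J) (ys i - g (xs i))| <= Num.sqrt (v * #|J|%:R)) ->
  `|local_average xs ys (knn_map k xs) x - g x| <=
  Num.sqrt (v / k%:R) + tau * local_lipschitz_const S g (knn_map k xs x).
Proof.
move=> k0 v0 Sx Sxs tau0 ktau Hnoise.
have [r0 rtau kr] := knn_radius_le tau0 ktau.
have := Hnoise _ r0; set r := knn_radius k xs x in r0 rtau kr *.
set J := [set i | _]%SET => noise.
rewrite count_inE -/J in kr.
have NJ0 : 0 < #|J|%:R :> R by rewrite (lt_le_trans _ kr)// ltr0n.
rewrite /local_average /knn_map -/r count_inE -/J.
set V := eucl_cball x r.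
have inV i : (xs i \in V) = (i \in J).
  by rewrite finset.inE; apply/idP/idP; rewrite inE.
have -> : \sum_(i < n) ys i * \1_V (xs i) = \sum_(i in J) ys i.
  rewrite [RHS]big_mkcond/=; apply: eq_bigr => i _.
  by rewrite indicE inV; case: (i \in J); rewrite ?mulr1 ?mulr0.
have -> : (\sum_(i in J) ys i) / #|J|%:R - g x =
   (\sum_(i in J) (ys i - g (xs i))) / #|J|%:R +
   (\sum_(i in J) (g (xs i) - g x)) / #|J|%:R.
  rewrite !sumrB sumr_const -mulr_natr; field.
  by rewrite gt_eqF.
apply: (le_trans (ler_normD _ _)); apply: lerD; rewrite normrM.
  rewrite (gtr0_norm (_ : 0 < #|J|%:R^-1)) ?invr_gt0//.
  apply: (@le_trans _ _ (Num.sqrt (v * #|J|%:R) / #|J|%:R)).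
    by rewrite ler_wpM2r// invr_ge0 ltW.
  rewrite ler_pdivrMr// -{2}(sqr_sqrtr (ltW NJ0)) expr2.
  rewrite sqrtrM// mulrA ler_wpM2r ?sqrtr_ge0// -sqrtrM; last first.
    by rewrite divr_ge0.
  rewrite ler_sqrt -?mulrA ?mulr_ge0 ?invr_ge0// ?ler0n//.
  by rewrite ler_peMr// mulrC ler_pdivlMr ?ltr0n// mul1r.
rewrite (gtr0_norm (_ : 0 < #|J|%:R^-1)) ?invr_gt0// ler_pdivrMr//.
apply: (le_trans (ler_norm_sum _ _ _)).
rewrite mulr_natr -sumr_const; apply: ler_sum => i iJ.
rewrite distrC.
have ir : eucl_dist x (xs i) <= r by move: iJ; rewrite finset.inE.
apply: local_lipschitz_const_bound => //; last exact: le_trans rtau.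
rewrite /V /eucl_cball/= /eucl_dist big1 ?sqrtr0// => j _.
by rewrite subrr expr0n.
Qed.

End deterministic.

Lemma bernoulli_1B (R : realFieldType) (s : R) (m : nat) :
  0 <= s <= 1 -> 1 - m%:R * s <= (1 - s) ^+ m.
Proof.
move=> /andP[s0 s1]; elim: m => [|m IH]; first by rewrite mul0r subr0 expr0.
rewrite exprS; apply: (@le_trans _ _ ((1 - s) * (1 - m%:R * s))); last first.
  by rewrite ler_wpM2l ?subr_ge0.
have : 0 <= m%:R * s * s by rewrite !mulr_ge0.
by rewrite -natr1; lra.
Qed.

(** The mass bound holds for radii below [T0], but the condition on [k] allows a radius equal to
    [T0]: let t = tau (1 - s) increase to [tau]. *)
Lemma distribution_ball_ge (R : realType) (d : nat)
    (mu : probability (d.-tuple R) R) (x : d.-tuple R)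
    (l T0 tau : R) :
  (0 < d)%N -> 0 < l -> 0 < tau -> tau <= T0 ->
  (forall t, 0 < t -> t < T0 -> ((l * t ^+ d)%:E <= mu (eucl_cball x t))%E) ->
  ((l * tau ^+ d)%:E <= mu (eucl_cball x tau))%E.
Proof.
move=> d0 l0 tau0 tauT H.
have muE : mu (eucl_cball x tau) = (fine (mu (eucl_cball x tau)))%:E.
  by rewrite fineK ?fin_num_measure//; exact: measurable_eucl_cball.
have Ht t : 0 < t -> t < tau -> l * t ^+ d <= fine (mu (eucl_cball x tau)).
  move=> t0 ttau; rewrite -lee_fin -muE.
  apply: (le_trans (H t t0 (lt_le_trans ttau tauT))).
  apply: le_measure; rewrite ?inE; try exact: measurable_eucl_cball.
  by move=> y; rewrite /eucl_cball/= => /le_trans; apply; exact: ltW.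
rewrite muE lee_fin leNgt; apply/negP => h.
set M := fine _ in Ht h; set a := l * tau ^+ d in h.
have M0 : 0 <= M by rewrite fine_ge0.
have [s /andP[s0 s1] sa] : exists2 s, 0 < s < 1 & M < a * (1 - d%:R * s).
  have a0 : 0 < a := le_lt_trans M0 h.
  have d1 : 1 <= d%:R :> R by rewrite ler1n.
  (* This [s] makes a (1 - d s) the midpoint of [M] and [a]; Bernoulli's inequality then bounds (1 -
     s)^d from below by 1 - d s. *)
  clearbody a M; exists ((a - M) / (2 * a * d%:R)).
    have q0 : 0 < 2 * a * d%:R by rewrite pmulr_lgt0 ?mulr_gt0// (lt_le_trans ltr01).
    rewrite divr_gt0 ?subr_gt0//= ltr_pdivrMr// mul1r.
    by have : a * 1 <= a * d%:R; [rewrite ler_wpM2l// ltW|lra].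
  rewrite (_ : _ * (1 - _) = (a + M) / 2); first by lra.
  by field; rewrite !gt_eqF// (lt_le_trans ltr01).
have := Ht (tau * (1 - s)); rewrite mulr_gt0 ?subr_gt0// => /(_ isT).
rewrite gtr_pMr// ltrBlDl ltrDr s0 => /(_ isT); apply/negP; rewrite -ltNge.
rewrite exprMn mulrA -/a (lt_le_trans sa)// ler_wpM2l//.
  by rewrite (ltW (le_lt_trans M0 h)).
by rewrite bernoulli_1B// (ltW s0) (ltW s1).
Qed.

(** * Transfer of the hypotheses to the sample *)

(** The index [None] is the generic pair: independence is used on the indices [Some i], and the
    common law is read off at [None]. *)
Lemma iid_iid_law dO dT (O : measurableType dO) (T : measurableType dT)
    (R : realType) (n : nat) (P : probability O R) (Z : 'I_n -> O -> T)
    (Z0 : O -> T) (mu : probability T R) :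
  (forall i, measurable_fun setT (Z i)) ->
  (forall A, measurable A -> mu A = P (Z0 @^-1` A)) ->
  iid P (oapp Z Z0) -> iid_law P Z mu.
Proof.
move=> mZ muE [indep same]; split => // A mA.
pose A' := oapp A setT.
have mA' o : measurable (A' o) by case: o => [i|]; [exact: mA|exact: measurableT].
have := indep [set Some i | i in [set: 'I_n]]%SET A' mA'.
rewrite big_imset/=; last by move=> ? ? _ _ [].
under eq_bigl do rewrite finset.in_setT.
have E i : (P (Z i @^-1` A i) = mu (A i))%E.
  by rewrite muE//; exact: (same (Some i) None).
under eq_bigr do rewrite E.
move=> <-; congr (P _); apply/seteqP; split => w /=.
  by move=> h _ /imsetP[i _ ->]; exact: h.
by move=> h i; apply: (h (Some i)); exact: imset_f.
Qed.

Lemma condexp_le dO dT (O : measurableType dO) (T : measurableType dT)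
    (R : realType) (P : probability O R) (X : O -> T) (W : O -> R) (h : T -> R)
    (c : R) (A : set T) :
  measurable_fun setT X -> is_condexp P X W h -> 0 <= c ->
  {ae P, forall w, h (X w) <= c} -> measurable A ->
  (\int[P]_(w in X @^-1` A) (W w)%:E <= c%:E * P (X @^-1` A))%E.
Proof.
move=> mX [_ mh hE] c0 hc mA; rewrite hE//.
have mXA : measurable (X @^-1` A).
  by rewrite -[X in measurable X]setTI; exact: mX.
have mhX : measurable_fun (X @^-1` A) (fun w => (h (X w))%:E).
  apply/measurable_EFinP; apply: measurable_funTS.
  exact: (measurableT_comp mh mX).
rewrite integralE -integral_cst//.
(* [h] may take negative values. Its positive part is still at most [c] almost everywhere, because
   [c] is nonnegative. *)
apply: (@le_trans _ _ (\int[P]_(w in X @^-1` A) (fun w => (h (X w))%:E)^\+ w)%E).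
  by rewrite -[leRHS]sube0 leeB// integral_ge0.
apply: ae_ge0_le_integral => //.
- by apply: measurable_funepos.
- move: hc; apply: filterS => w hw _.
  by rewrite funeposE -EFin_max lee_fin ge_max hw.
Qed.

Lemma iid_subgaussian dO dT dX (O : measurableType dO) (T : measurableType dT)
    (TX : measurableType dX) (R : realType) (n : nat) (P : probability O R)
    (Z : 'I_n -> O -> T) (Z0 : O -> T) (mu : probability T R) (X : T -> TX)
    (e : T -> R) (sigma : R) :
  iid_law P Z mu -> measurable_fun setT Z0 ->
  (forall A, measurable A -> mu A = P (Z0 @^-1` A)) ->
  measurable_fun setT X -> measurable_fun setT e ->
  cond_subgaussian P (X \o Z0) (e \o Z0) sigma ->
  subgaussian_given P Z X e sigma.
Proof.
move=> Zlaw mZ0 muE mX me [_ He]; split => // i s A mA.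
have [h hE hle] := He s.
pose F (t : T) : \bar R := (\1_A (X t) * expR (s * e t))%:E.
have mF : measurable_fun setT F.
  apply/measurable_EFinP; apply: measurable_funM.
    rewrite (_ : (fun t => _) = \1_(X @^-1` A)).
      by apply: measurable_indic; rewrite -[X in measurable X]setTI; exact: mX.
    by apply/funext => t; rewrite !indicE.
  by apply: measurableT_comp => //; exact: measurable_funM.
have mXA : measurable (X @^-1` A).
  by rewrite -[X in measurable X]setTI; exact: mX.
have -> : P [set w | A (X (Z i w))] = P ((X \o Z0) @^-1` A).
  by rewrite [LHS](iid_law_marginal i Zlaw mXA) muE.
have -> : (\int[P]_w F (Z i w) = \int[P]_w F (Z0 w))%E.
  (* Equality of the laws of two single variables, as families indexed by ['I_1]. *)
  apply: (@eq_law_integral _ _ _ _ _ _ _ 1 P P (fun=> Z i) (fun=> Z0)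
    (fun t => F (t ord0))) => //.
  - by apply: (@le_lt_trans _ _ 1%E); [exact: probability_le1|exact: ltry].
  - by move=> _; exact: Zlaw.1.
  - move=> B mB.
    have E (z : O -> T) : [set w | forall j : 'I_1, B j (z w)] = z @^-1` B ord0.
      by apply/seteqP; split => w /= hB => [|j]; [exact: hB|rewrite (ord1 j)].
    by rewrite !E [LHS](iid_law_marginal i Zlaw)// muE.
  - by apply: (measurableT_comp mF); exact: measurable_tnth.
  - by move=> t; rewrite lee_fin mulr_ge0// expR_ge0.
have := condexp_le (measurableT_comp mX mZ0) hE (expR_ge0 _) hle mA.
apply: le_trans; rewrite [leRHS]integral_mkcond le_eqVlt; apply/orP; left.
apply/eqP; apply: eq_integral => w _; rewrite patchE /F indicE /=.
have [AX|nAX] := pselect (A (X (Z0 w))).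
  by rewrite !mem_set//= mulr1n mul1r.
by rewrite !memNset//= mulr0n mul0r.
Qed.

(** From 1 - 1/8 <= exp(-1/8) comes exp(1/8) <= 8/7. This is the source of the factor 8 in the
    condition on [k]. *)
Lemma expR_eighth_le (R : realType) : expR (1 / 8) <= 32 / 27 :> R.
Proof.
have := expR_ge1Dx (- (1 / 8) : R); rewrite expRN => h.
have e0 := expR_gt0 (1 / 8 : R).
have : (1 + - (1 / 8)) * expR (1 / 8) <= 1 :> R.
  by rewrite -ler_pdivlMr// [leRHS]div1r.
by lra.
Qed.

Lemma log_condition (R : realType) (d n k : nat) (delta : R) :
  0 < delta ->
  8 * ln (4 * (2 * n + 1)%:R ^+ d.+1 / delta) <= k%:R ->
  (n + n).+1%:R ^+ d.+1 <= delta * (32 / 27) ^+ k.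
Proof.
move=> d0 h.
have N0 : 0 < 4 * (2 * n + 1)%:R ^+ d.+1 / delta :> R.
  by rewrite divr_gt0// mulr_gt0// exprn_gt0// addn1 ltr0n.
have {h} : 4 * (2 * n + 1)%:R ^+ d.+1 / delta <= (32 / 27) ^+ k :> R.
  rewrite -[leLHS]lnK ?posrE//.
  apply: (@le_trans _ _ (expR (1 / 8) ^+ k)).
    by rewrite -expRM_natl ler_expR; lra.
  by rewrite lerXn2r// ?nnegrE ?expR_ge0 ?expR_eighth_le// divr_ge0.
rewrite ler_pdivrMr// [in leRHS]mulrC => h.
rewrite (_ : (n + n).+1 = (2 * n + 1)%N); last by rewrite addn1 mul2n addnn.
apply: le_trans h.
by rewrite ler_peMl// ?exprn_ge0// ler1n.
Qed.

(** * Combining the three exceptional events *)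

Theorem theorem13 (disp : measure_display) (Omega : measurableType disp)
    (R : realType) (P : probability Omega R) (d n k : nat) (delta : R)
    (S : set (d.-tuple R))
    (X : {RV P >-> d.-tuple R}) (Y : {RV P >-> R})
    (Xs : 'I_n -> {RV P >-> d.-tuple R}) (Ys : 'I_n -> {RV P >-> R})
    (g : d.-tuple R -> R) (sigma L : R) (ell : d.-tuple R -> R) (T0 : R) :
  0 < delta -> delta < 1 / 3 ->
  (1 <= n)%N -> (1 <= d)%N -> (1 <= k <= n)%N ->
  8 * ln (4 * (2 * n + 1)%:R ^+ d.+1 / delta) <= k%:R ->
  {ae distribution P X, forall x, S x} ->
  is_condexp P X Y g ->
  iid P (oapp (fun (i : 'I_n) w => (Xs i w, Ys i w)) (fun w => (X w, Y w))) ->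
  cond_subgaussian P X (fun w => Y w - g (X w)) sigma ->
  eucl_lipschitz_on L S g ->
  (forall x, S x -> 0 < ell x) -> 0 < T0 ->
  (forall x tau, S x -> 0 < tau -> tau < T0 ->
     ((ell x * tau ^+ d)%:E <= distribution P X (eucl_cball x tau))%E) ->
  with_probability_at_least P (1 - 3 * delta)
    [set w | let xs := fun i => Xs i w in
             let ys := fun i => Ys i w in
             let V := knn_map k xs in
      forall x, S x -> 2 * k%:R <= T0 ^+ d * n%:R * ell x ->
        `|local_average xs ys V x - g x| <=
          Num.sqrt (2 * sigma ^+ 2 / k%:R *
                    ln ((n + 1)%:R ^+ d.+1 / delta)) +
          2 * (2 * k%:R / (n%:R * ell x)) `^ (d%:R^-1) *
            local_lipschitz_const S g (V x)].
Proof.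
move=> delta0 delta3 n0 d0 /andP[k0 kn] logk aeS [_ mg _] iidXY subg gL ell0 T00 small.
pose Z (i : 'I_n) w := (Xs i w, Ys i w); pose Z0 w := (X w, Y w).
have mZ i : measurable_fun setT (Z i) by exact: measurable_fun_pair.
have mZ0 : measurable_fun setT Z0 by exact: measurable_fun_pair.
pose Z0' : {RV P >-> (d.-tuple R * R)%type} := mfun_Sub (mem_set mZ0).
have Zlaw : iid_law P Z (distribution P Z0') by exact: (iid_iid_law (Z0 := Z0)).
have Xlaw : iid_law P (fun i => Xs i) (distribution P X).
  split=> // A mA; pose A' i := A i `*` [set: R].
  have mA' i : measurable (A' i) by exact: measurableX.
  have E i : distribution P Z0' (A' i) = distribution P X (A i).
    by congr (P _); apply/seteqP; split => w /= => [[]|].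
  transitivity (P [set w | forall i, A' i (Z i w)]); last first.
    by rewrite Zlaw.2//; apply: eq_bigr => i _; exact: E.
  congr (P _); apply/seteqP; split => w /= h i.
    by split => //; exact: h.
  by have [] := h i.
pose e (t : d.-tuple R * R) := t.2 - g t.1.
have me : measurable_fun setT e.
  by apply: measurable_funB => //; exact: measurableT_comp.
have He : subgaussian_given P Z fst e sigma.
  exact: (iid_subgaussian (Z0 := Z0) Zlaw).
pose Lam := ln ((n + 1)%:R ^+ d.+1 / delta).
have N1 : 1 <= (n + 1)%:R ^+ d.+1 :> R by rewrite exprn_ege1// ler1n addn1.
have delta1 : delta <= 1 by lra.
have Nd : 0 < (n + 1)%:R ^+ d.+1 / delta by rewrite divr_gt0// (lt_le_trans ltr01).
have Lam0 : 0 <= Lam.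
  by rewrite ln_ge0// ler_pdivlMr// mul1r (le_trans delta1).
have eLam : (n + 1)%:R ^+ d.+1 * expR (- Lam) <= delta.
  have NN0 : (n + 1)%:R ^+ d.+1 != 0 :> R by rewrite gt_eqF// (lt_le_trans ltr01).
  by rewrite expRN lnK ?posrE// invf_div mulrC divfK.
(* [B1] (noise) costs [2 * delta] and [B2] (radius) costs [delta]. [B3] is null: off it all design
   points lie in [S], through a measurable null set [N] containing the complement of [S]. *)
have [B1 [mB1 PB1] HB1] := noise_bound_ball_traces Zlaw measurable_fst He Lam0 eLam.
have [B2 [mB2 PB2] HB2] := undersampled_balls Xlaw delta0 (log_condition delta0 logk).
have [N [mN N0 SN]] := aeS.
have mXN (i : 'I_n) : measurable (Xs i @^-1` N).
  by rewrite -[X in measurable X]setTI; exact: measurable_funPT.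
have [mB3 PB3] := measure_fin_bigcup_le P (index_enum 'I_n) mXN.
set B3 := \big[setU/set0]_(i <- _) _ in mB3 PB3.
have {}PB3 : (P B3 <= 0)%E.
  apply: (le_trans PB3); rewrite big1// => i _.
  by rewrite (iid_law_marginal i Xlaw).
have mB : measurable (B1 `|` B2 `|` B3) by do 2! apply: measurableU => //.
exists (~` (B1 `|` B2 `|` B3)); split; first exact: measurableC.
  rewrite probability_setC// EFinB leeB//.
  apply: (le_trans (measureU2 _ _ _)) => //; first exact: measurableU.
  rewrite (_ : (3 * delta)%:E = ((2 * delta)%:E + delta%:E + 0)%E); last first.
    by rewrite adde0 -EFinD; congr EFin; ring.
  apply: leeD => //; apply: (le_trans (measureU2 _ _ _)) => //.
  exact: leeD.
move=> w nB xs ys V x Sx kT.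
have nB1 : ~ B1 w by move=> ?; apply: nB; left; left.
have nB2 : ~ B2 w by move=> ?; apply: nB; left; right.
have Sxs i : S (xs i).
  apply: contrapT => nS; apply: nB; right; rewrite /B3 -bigcup_seq.
  by exists i; rewrite /= ?mem_index_enum//; exact: SN.
have lx := ell0 x Sx.
have nR : 0 < n%:R :> R by rewrite ltr0n.
have kR : 0 < k%:R :> R by rewrite ltr0n.
have dR : d%:R != 0 :> R by rewrite pnatr_eq0 -lt0n.
(* [tau] solves ell(x) tau^d = 2k/n, the mass that [B2] asks for; the condition on [x] says exactly
   that [tau] is at most [T0]. *)
set y := 2 * k%:R / (n%:R * ell x).
have y0 : 0 < y by rewrite divr_gt0 ?mulr_gt0.
set tau := y `^ d%:R^-1.
have tau0 : 0 < tau by exact: powR_gt0.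
have taud : tau ^+ d = y.
  by rewrite -powR_mulrn ?(ltW tau0)// /tau -powRrM mulVf// powRr1// ltW.
have tauT : tau <= T0.
  rewrite -(@ler_pXn2r _ d)// ?nnegrE ?(ltW tau0) ?(ltW T00)// taud.
  by rewrite ler_pdivrMr ?mulr_gt0// mulrA.
have muball := distribution_ball_ge d0 lx tau0 tauT (small x ^~ Sx).
have kball : k%:R <= count_in xs (eucl_cball x tau).
  apply: (HB2 w nB2); first exact: ltW.
  apply: (@le_trans _ _ (n%:R%:E * (ell x * tau ^+ d)%:E)%E).
    rewrite -EFinM lee_fin taud le_eqVlt; apply/orP; left; apply/eqP.
    by rewrite /y natrM; field; rewrite !gt_eqF.
  by rewrite lee_wpmul2l// lee_fin ltW.
apply: (le_trans (knn_error_bound (v := 2 * sigma ^+ 2 * Lam) gL k0 _ Sx Sxs tau0 kball _)).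
- by rewrite mulr_ge0// mulr_ge0// sqr_ge0.
(* The noise bound holds for all traces at once, so it applies to a ball whose radius depends on the
   sample. *)
- move=> r J r0; have := HB1 w nB1 J; rewrite mulrAC => h.
  apply: h.
  exact: ball_traceP.
apply: lerD.
  by rewrite -/Lam mulrAC.
rewrite ler_wpM2r ?(local_lipschitz_const_ge0 gL)//.
by rewrite ler_peMl ?(ltW tau0)// ler1n.
Qed.
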